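(* Let $(\delta,K_1,K_2,C_0,C_1,\mathcal S)$ be a primitive admissible sequence of parameters such that $\mathcal S$ is a non-empty set of Henson constraints. Then $\mathcal K=\mathcal A^\delta_{K_1,K_2,C_0,C_1}\cap\mathcal A_{\mathcal S}$ has coherent EPPA.
   Context: $\mathcal A^\delta_{K_1,K_2,C_0,C_1}$ is the class of finite metric spaces with integer distances in $\{1,\dots,\delta\}$ such that for every triangle with perimeter $p$ and shortest side $m$: if $p$ odd then $2K_1<p<2K_2+2m$ and $p<C_1$; if $p$ even then $p<C_0$. With $C=\min(C_0,C_1)$, $C'=\max(C_0,C_1)$, numerical parameters are primitive admissible if: $3\le\delta<\infty$; $1\le K_1\le K_2\le 2\delta$; $2\delta<C_0,C_1\le3\delta+2$, $C_0$ even, $C_1$ odd; $C_0,C_1\ge 2\delta+2$; and either (II) $C\le 2\delta+K_1$, $C=2K_1+2K_2+1$, $K_1+K_2\ge\delta$, $K_1+2K_2\le 2\delta-1$, and ($C'=C+1$, or $C'>C+1$, $K_1=K_2$, $3K_2=2\delta-1$); or (III) $C>2\delta+K_1$, $K_1+2K_2\ge2\delta-1$, $3K_2\ge2\delta$, if $K_1+2K_2=2\delta-1$ then $C\ge2\delta+K_1+2$, and if $C'>C+1$ then $C\ge 2\delta+K_2$. A Henson constraint is a metric space all of whose distances are $1$ or $\delta$. $\mathcal A_{\mathcal S}$ is the class of finite metric spaces into which no member of $\mathcal S$ embeds. The sequence $(\delta,K_1,K_2,C_0,C_1,\mathcal S)$ is primitive admissible if the numerical parameters are, $\mathcal S$ is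 a set of such spaces each with at least 4 points and containing no triangle forbidden in $\mathcal A^\delta_{K_1,K_2,C_0,C_1}$, and in Case (III): if $K_1=\delta$ or $C=2\delta+2$ then $\mathcal S=\emptyset$. A class $\mathcal K$ has coherent EPPA if for every $\mathbf A\in\mathcal K$ there is $\mathbf B\in\mathcal K$ containing $\mathbf A$ as a substructure such that every partial automorphism $f$ (isomorphism between substructures) of $\mathbf A$ extends to an automorphism $\hat f$ of $\mathbf B$, and the map $f\mapsto\hat f$ is coherent: whenever $\mathrm{Dom}(f)=\mathrm{Dom}(h)$, $\mathrm{Range}(f)=\mathrm{Dom}(g)$, $\mathrm{Range}(g)=\mathrm{Range}(h)$ and $h=g\circ f$, also $\hat h=\hat g\circ\hat f$. *)

(* Defs.v *)
From HB Require Import structures.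
From mathcomp Require Import all_boot.

Set Implicit Arguments.
Unset Strict Implicit.
Unset Printing Implicit Defensive.

Definition is_metric (T : Type) (d : T -> T -> nat) : Prop :=
  [/\ forall x y, d x y = 0 <-> x = y,
      forall x y, d x y = d y x
    & forall x y z, d x z <= d x y + d y z].

(* Integer-valued metric spaces; the carrier may be infinite or empty. *)
Record metricSpace := MetricSpace {
  ms_sort :> Type;
  dist : ms_sort -> ms_sort -> nat;
  dist_metric : is_metric dist
}.

Record finMetricSpace := FinMetricSpace {
  fms_sort :> finType;
  fdist : fms_sort -> fms_sort -> nat;
  fdist_metric : is_metric fdist
}.

Coercion metric_of_fin (A : finMetricSpace) : metricSpace :=
  MetricSpace (fdist_metric A).

(* Distance-preserving maps are automatically injective. *)
Definition embedding (X Y : metricSpace) (e : X -> Y) : Prop :=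
  forall x y : X, dist (e x) (e y) = dist x y.

Definition embeds (X Y : metricSpace) : Prop :=
  exists e : X -> Y, embedding e.

Definition automorphism (X : metricSpace) (phi : X -> X) : Prop :=
  bijective phi /\ embedding phi.

Definition triangle_allowed (K1 K2 C0 C1 a b c : nat) : Prop :=
  let p := a + b + c in
  let m := minn a (minn b c) in
  (odd p -> [/\ 2 * K1 < p, p < 2 * K2 + 2 * m & p < C1]) /\
  (~~ odd p -> p < C0).

(* A triangle consists of three pairwise distinct points. *)
Definition no_forbidden_triangle (K1 K2 C0 C1 : nat) (X : metricSpace) : Prop :=
  forall x y z : X, x <> y -> y <> z -> x <> z ->
    triangle_allowed K1 K2 C0 C1 (dist x y) (dist y z) (dist x z).

Definition class_A (delta K1 K2 C0 C1 : nat) (A : finMetricSpace) : Prop :=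
  (forall x y : A, x <> y -> 1 <= fdist x y <= delta) /\
  no_forbidden_triangle K1 K2 C0 C1 A.

Definition class_AS (S : metricSpace -> Prop) (A : finMetricSpace) : Prop :=
  forall X : metricSpace, S X -> ~ embeds X A.

Definition henson_constraint (delta : nat) (X : metricSpace) : Prop :=
  forall x y : X, x <> y -> dist x y = 1 \/ dist x y = delta.

Section Admissible.

Variables delta K1 K2 C0 C1 : nat.

Let C := minn C0 C1.
Let C' := maxn C0 C1.

Definition case_II : Prop :=
  [/\ C <= 2 * delta + K1,
      C = 2 * K1 + 2 * K2 + 1,
      K1 + K2 >= delta,
      K1 + 2 * K2 <= 2 * delta - 1
    & C' = C + 1 \/ [/\ C' > C + 1, K1 = K2 & 3 * K2 = 2 * delta - 1]].

Definition case_III : Prop :=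
  [/\ C > 2 * delta + K1,
      K1 + 2 * K2 >= 2 * delta - 1,
      3 * K2 >= 2 * delta,
      K1 + 2 * K2 = 2 * delta - 1 -> C >= 2 * delta + K1 + 2
    & C' > C + 1 -> C >= 2 * delta + K2].

Definition primitive_admissible_num : Prop :=
  3 <= delta /\
  [/\ 1 <= K1, K1 <= K2 & K2 <= 2 * delta] /\
  [/\ 2 * delta < C0 <= 3 * delta + 2, 2 * delta < C1 <= 3 * delta + 2,
      ~~ odd C0 & odd C1] /\
  (2 * delta + 2 <= C0 /\ 2 * delta + 2 <= C1) /\
  (case_II \/ case_III).

Definition primitive_admissible (S : metricSpace -> Prop) : Prop :=
  [/\ primitive_admissible_num,
      forall X : metricSpace, S X ->
        [/\ henson_constraint delta X,
            exists i : 'I_4 -> X, injective i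
          & no_forbidden_triangle K1 K2 C0 C1 X]
    & case_III -> K1 = delta \/ C = 2 * delta + 2 ->
        forall X : metricSpace, ~ S X].

End Admissible.

(* A partial map is a finite function into option; the substructures of a
   metric space are its arbitrary (possibly empty) subsets. *)
Section PartialMap.

Variable T : finType.
Implicit Types f g : {ffun T -> option T}.

Definition pdom f : {set T} := [set x | f x != None].
Definition prange f : {set T} := [set y | [exists x, f x == Some y]].
Definition pcomp g f : {ffun T -> option T} := [ffun x => obind g (f x)].

End PartialMap.

(* Preservation of distances makes f an isomorphism between the substructures
   pdom f and prange f. *)
Definition partial_automorphism (A : finMetricSpace)
    (f : {ffun A -> option A}) : Prop :=
  forall x y x' y' : A, f x = Some x' -> f y = Some y' ->
    fdist x' y' = fdist x y.

(* The copy of A inside B is given by an embedding e : A -> B. *)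
Definition coherent_EPPA (K : finMetricSpace -> Prop) : Prop :=
  forall A : finMetricSpace, K A ->
  exists B : finMetricSpace, K B /\
  exists e : A -> B, embedding (X := A) (Y := B) e /\
  exists ext : {ffun A -> option A} -> B -> B,
    (forall f, partial_automorphism f ->
       automorphism (X := B) (ext f) /\
       (forall x y : A, f x = Some y -> ext f (e x) = e y)) /\
    (forall f g h,
       partial_automorphism f -> partial_automorphism g ->
       partial_automorphism h ->
       pdom f = pdom h -> prange f = pdom g -> prange g = prange h ->
       h = pcomp g f ->
       ext h =1 ext g \o ext f).

(* Main.v *)
Require Import Defs.
From mathcomp Require Import all_boot.
From mathcomp Require Import ssralg zmodp zify boolp.

(* The finite space [A] is first embedded in a finite edge-labelled graph [V]
   to which all partial automorphisms extend coherently, in which every clique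
   is a copy of a subspace of [A], and in which every closed walk is good, where
   goodness is a condition on cyclic words of labels that survives gluing along
   a chord and holds for all long words. Such a graph is built by valuations: a
   vertex carries an extra value for every bad configuration, edges are kept
   only between compatible values, and the values are chosen so that the bad
   configuration does not lift. A shortest bad closed walk is an induced cycle,
   so it meets [A] in at most one edge; hence twisting the values along one edge
   of the cycle removes it without affecting the copy of [A].

   The missing distances of [V] are then filled in canonically: walks give upper
   and lower bounds for a distance, and a fixed middle value [M] is clamped to
   these bounds. The triangle conditions on the result are read off from the
   goodness of closed walks. Since no new distance equals 1 or [delta], every
   Henson constraint in the completed space is a clique of [V], hence lies in
   [A]. A non-empty [S] leaves Case (III) with [K1 < delta] and
   [C > 2 delta + 2], or Case (II) with [K1 = K2 = K], [3 K = 2 delta - 1],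
   [C1 = 4 K + 1], [C0 = 3 delta + 2], where the middle value has to be
   [K] or [K - 1] according to parity. *)

Set Implicit Arguments.
Unset Strict Implicit.
Unset Printing Implicit Defensive.

Import GRing.Theory.

(** * Coherent extension of partial injections *)

Definition composable (T : finType) (f g h : {ffun T -> option T}) : Prop :=
  [/\ pdom f = pdom h, prange f = pdom g, prange g = prange h & h = Defs.pcomp g f].

Section PartialInjection.

Variables (T : finType) (W : {set T}).
Implicit Types (p f g h : {ffun T -> option T}) (x y : T).

Definition pinjective p : Prop :=
  forall x y z, p x = Some z -> p y = Some z -> x = y.

Definition pinjective_in p : Prop :=
  [/\ pinjective p, pdom p \subset W & prange p \subset W].

Lemma mem_pdom p x y : p x = Some y -> x \in pdom p.
Proof. by rewrite inE => ->. Qed.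

Lemma mem_prange p x y : p x = Some y -> y \in prange p.
Proof. by move=> pxy; rewrite inE; apply/existsP; exists x; rewrite pxy. Qed.

Lemma pdomP p x : reflect (exists y, p x = Some y) (x \in pdom p).
Proof.
rewrite inE; case: (p x) => [y|]; constructor; first by exists y.
by case.
Qed.

Lemma prangeP p y : reflect (exists x, p x = Some y) (y \in prange p).
Proof.
by rewrite inE; apply: (iffP existsP) => -[x /eqP]; exists x => //; apply/eqP.
Qed.

Lemma pdomPn p x : x \notin pdom p -> p x = None.
Proof. by rewrite inE negbK => /eqP. Qed.

Lemma card_pdom p : pinjective p -> #|pdom p| = #|prange p|.
Proof.
move=> pI; have -> : prange p = [set odflt x (p x) | x in pdom p].
  apply/setP=> y; apply/prangeP/imsetP => [[x pxy]|[x /pdomP[z pxz] ->]].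
    by exists x; rewrite ?pxy // (mem_pdom pxy).
  by exists x; rewrite pxz.
rewrite card_in_imset // => x y /pdomP[x' px] /pdomP[y' py].
by rewrite px py /= => exy; apply: pI px _; rewrite exy.
Qed.

(* The complements of domain and range in [W] are matched in enumeration
   order; outside [W] the index overflows, so [nth] returns its default [x]. *)
Definition pext p x : T :=
  if p x is Some y then y
  else nth x (enum (W :\: prange p)) (index x (enum (W :\: pdom p))).

Lemma size_pext p : pinjective_in p ->
  size (enum (W :\: pdom p)) = size (enum (W :\: prange p)).
Proof.
case=> pI /setIidPr dW /setIidPr rW.
by rewrite -!cardE !cardsD dW rW card_pdom.
Qed.

Lemma pext_Some p x y : p x = Some y -> pext p x = y.
Proof. by rewrite /pext => ->. Qed.

Lemma pext_None p x : pinjective_in p -> x \in W -> p x = None ->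
  pext p x \in W :\: prange p /\
  index (pext p x) (enum (W :\: prange p)) = index x (enum (W :\: pdom p)).
Proof.
move=> pP xW pN; rewrite /pext pN.
have ix : index x (enum (W :\: pdom p)) < size (enum (W :\: prange p)).
  by rewrite -size_pext // index_mem mem_enum !inE pN xW.
split; last by rewrite index_uniq ?enum_uniq.
by rewrite -mem_enum mem_nth.
Qed.

Lemma pext_out p x : pinjective_in p -> x \notin W -> pext p x = x.
Proof.
move=> pP xW; have [pI dW rW] := pP; rewrite /pext.
case E: (p x) => [y|].
  by case/negP: xW; apply: (subsetP dW); apply: mem_pdom E.
rewrite nth_default // -size_pext // leqNgt index_mem mem_enum inE.
by rewrite (negPf xW) andbF.
Qed.

Lemma pext_mem p x : pinjective_in p -> (pext p x \in W) = (x \in W).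
Proof.
move=> pP; have [pI dW rW] := pP.
case xW: (x \in W); last by rewrite pext_out ?xW.
case E: (p x) => [y|].
  by rewrite (pext_Some E); apply/(subsetP rW)/(mem_prange E).
by case: (pext_None pP xW E); rewrite inE => /andP[].
Qed.

Lemma pext_inj p : pinjective_in p -> injective (pext p).
Proof.
move=> pP x y; have [pI dW rW] := pP => eqxy.
have := pext_mem x pP; rewrite eqxy pext_mem // => eqW.
have [xW|xW] := boolP (x \in W); last first.
  by rewrite -[x](pext_out pP xW) eqxy pext_out // eqW.
have yW : y \in W by rewrite eqW.
case Ex: (p x) => [x'|]; case Ey: (p y) => [y'|].
- move: eqxy; rewrite (pext_Some Ex) (pext_Some Ey) => e.
  by apply: pI Ex _; rewrite e.
- have [] := pext_None pP yW Ey; rewrite -eqxy (pext_Some Ex) inE.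
  by rewrite (mem_prange Ex).
- have [] := pext_None pP xW Ex; rewrite eqxy (pext_Some Ey) inE.
  by rewrite (mem_prange Ey).
have [_ ix] := pext_None pP xW Ex; have [_ iy] := pext_None pP yW Ey.
rewrite -[x](nth_index x (s := enum (W :\: pdom p))) ?mem_enum ?inE ?Ex ?xW //.
by rewrite -ix eqxy iy nth_index // mem_enum !inE Ey yW.
Qed.

(** The complements of [pdom f], of [prange f] (equal to [pdom g]) and of [prange g] are matched in
    enumeration order. An unmatched point keeps its index at each step, and index-preserving
    matchings compose. *)
Lemma pext_comp f g h : pinjective_in f -> pinjective_in g ->
  composable f g h -> pext h =1 pext g \o pext f.
Proof.
move=> fP gP [dfh rfg rgh eh] x /=.
have [xW|xW] := boolP (x \in W); last first.
  rewrite (pext_out fP xW) (pext_out gP xW) /pext.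
  have [fI dW rW] := fP; have /pdomPn -> : x \notin pdom h.
    by rewrite -dfh; apply: contra xW; apply: (subsetP dW).
  rewrite nth_default // -dfh -rgh -size_pext // -rfg -size_pext //.
  by rewrite leqNgt index_mem mem_enum inE (negPf xW) andbF.
case E: (f x) => [y|].
  rewrite (pext_Some E).
  have : y \in pdom g by rewrite -rfg; apply: mem_prange E.
  by case/pdomP=> z gyz; rewrite (pext_Some gyz) /pext eh ffunE E /= gyz.
have [yW iy] := pext_None fP xW E.
have gN : g (pext f x) = None.
  by apply: pdomPn; rewrite -rfg; move: yW; rewrite inE => /andP[].
rewrite {1}/pext eh ffunE E /= -eh {1}/pext gN -rfg iy -rgh -dfh.
apply: set_nth_default.
by rewrite -size_pext // -rfg -size_pext // index_mem mem_enum !inE E xW.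
Qed.

End PartialInjection.

Arguments pext_Some {T W p x y}.

(** * Extending partial automorphisms along valuations *)

(** Since [V] is finite, injectivity already makes [ext f] a permutation. Preservation of labels is
    kept apart, because a valuation step proves the two independently. *)
Definition coherent_extension (A : finMetricSpace) (V : finType) (e : A -> V)
    (ext : {ffun A -> option A} -> V -> V) : Prop :=
  [/\ forall f, partial_automorphism f -> injective (ext f),
      forall f, partial_automorphism f ->
        forall a b, f a = Some b -> ext f (e a) = e b
    & forall f g h, partial_automorphism f -> partial_automorphism g ->
        partial_automorphism h -> composable f g h -> ext h =1 ext g \o ext f].

Lemma partial_automorphism_inj (A : finMetricSpace) (f : {ffun A -> option A}) :
  partial_automorphism f -> pinjective f.
Proof.
move=> fP x y z fx fy; have [d0 _ _] := fdist_metric A.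
by apply/d0; rewrite -(fP _ _ _ _ fx fy); apply/d0.
Qed.

Lemma mem_pdom_ext (A : finMetricSpace) (f g : {ffun A -> option A})
    (V : finType) (e : A -> V) F (a b : A) :
  injective e -> injective F ->
  (forall a b, f a = Some b -> F (e a) = e b) ->
  prange f = pdom g -> F (e a) = e b -> (b \in pdom g) = (a \in pdom f).
Proof.
move=> eI FI Fe <- Fab; apply/prangeP/pdomP => [[c fcb]|[c fac]].
  exists b; rewrite -fcb; congr (f _); apply/eI/FI.
  by rewrite Fab (Fe _ _ fcb).
by exists a; rewrite fac; congr Some; apply: eI; rewrite -(Fe _ _ fac).
Qed.

Section Valuation.

Variables (A : finMetricSpace) (V I W : finType) (e : A -> V).
Variables (ext : {ffun A -> option A} -> V -> V).
Variables (act : {ffun A -> option A} -> I -> I).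
Variables (flip : {ffun A -> option A} -> V -> I -> W -> W).
Variable chi : A -> {ffun I -> W}.
Implicit Types f g h : {ffun A -> option A}.

(** Indices are permuted along with vertices, and [flip] corrects the value found at each index.
    [finv] is a true inverse as soon as [act f] is injective. *)
Definition val_ext f (u : V * {ffun I -> W}) : V * {ffun I -> W} :=
  (ext f u.1,
   [ffun i => flip f u.1 (finv (act f) i) (u.2 (finv (act f) i))]).

Definition val_emb (a : A) : V * {ffun I -> W} := (e a, chi a).

Hypothesis extP : coherent_extension e ext.
Hypothesis act_inj : forall f, partial_automorphism f -> injective (act f).
Hypothesis actM : forall f g h, partial_automorphism f ->
  partial_automorphism g -> partial_automorphism h ->
  composable f g h -> act h =1 act g \o act f.
Hypothesis flip_inj : forall f x i, partial_automorphism f ->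
  injective (flip f x i).
Hypothesis flip_emb : forall f a b i, partial_automorphism f ->
  f a = Some b -> flip f (e a) i (chi a i) = chi b (act f i).
Hypothesis flipM : forall f g h, partial_automorphism f ->
  partial_automorphism g -> partial_automorphism h -> composable f g h ->
  forall x i, flip h x i =1 flip g (ext f x) (act f i) \o flip f x i.

Lemma val_ext_act f u i : partial_automorphism f ->
  (val_ext f u).2 (act f i) = flip f u.1 i (u.2 i).
Proof. by move=> fP; rewrite ffunE (finv_f (act_inj fP)). Qed.

Lemma eq_val f (F G : {ffun I -> W}) : partial_automorphism f ->
  (forall i, F (act f i) = G (act f i)) -> F = G.
Proof.
by move=> fP FG; apply/ffunP=> i; rewrite -(f_finv (act_inj fP) i).
Qed.

(** [flipM] is a cocycle identity over the actions on vertices and indices; it turns coherence of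
    [ext] and [act] into coherence of the extension. *)
Lemma val_coherent : coherent_extension val_emb val_ext.
Proof.
have [extI extE extM] := extP; split.
- move=> f fP [x F] [y G] eq.
  have /= /(extI _ fP) exy := congr1 fst eq; rewrite -exy in eq *.
  congr pair; apply/ffunP=> i; apply: (@flip_inj f x i fP).
  by rewrite -!(val_ext_act (x, _)) // eq.
- move=> f fP a b fab; rewrite /val_emb; congr pair; first exact: extE.
  apply: (eq_val fP) => i.
  by have /= -> := val_ext_act (e a, chi a) i fP; apply: flip_emb.
move=> f g h fP gP hP fgh [x F].
rewrite [LHS]surjective_pairing [RHS]surjective_pairing.
congr pair; first by rewrite /= (extM f g h).
apply: (eq_val hP) => i; rewrite val_ext_act // (actM fP gP hP fgh).
have /= -> := val_ext_act (val_ext f (x, F)) (act f i) gP.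
by have /= -> := val_ext_act (x, F) i fP; apply: flipM.
Qed.

End Valuation.

Arguments val_ext_act {A V I W ext act flip} _ {f} u i.

(** * Edge-labelled EPPA-witnesses *)

(* The label [0] stands for a non-edge. *)
Record witness (A : finMetricSpace) (delta : nat) (V : finType)
    (l : V -> V -> nat) (e : A -> V)
    (ext : {ffun A -> option A} -> V -> V) : Prop := Witness {
  wit_ext : coherent_extension e ext;
  wit_aut : forall f, partial_automorphism f ->
    forall u v, l (ext f u) (ext f v) = l u v;
  wit_sym : forall u v, l u v = l v u;
  wit_irr : forall u, l u u = 0;
  wit_le : forall u v, l u v <= delta;
  wit_emb : forall a b, l (e a) (e b) = fdist a b
}.

Definition clique (V : finType) (l : V -> V -> nat) (Q : {set V}) : Prop :=
  {in Q &, forall u v, u != v -> 0 < l u v}.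

(** On a clique the labels are positive, so [j] is injective there and gives an isometric copy
    inside [A]. The boolean form lets valuations be defined by cases on it. *)
Definition clique_maps (A : finMetricSpace) (V : finType) (l : V -> V -> nat)
    (Q : {set V}) : bool :=
  [exists j : {ffun V -> A}, [forall u in Q, forall v in Q,
     (u != v) ==> (fdist (j u) (j v) == l u v)]].

Lemma clique_mapsP (A : finMetricSpace) (V : finType) (l : V -> V -> nat)
    (Q : {set V}) :
  reflect (exists j : V -> A,
             {in Q &, forall u v, u != v -> fdist (j u) (j v) = l u v})
          (clique_maps A l Q).
Proof.
apply: (iffP existsP) => [[j jP]|[j jP]].
  exists j => u v uQ vQ uv; apply/eqP.
  by move/forall_inP: jP => /(_ _ uQ) /forall_inP /(_ _ vQ) /implyP; apply.
exists [ffun u => j u]; apply/forall_inP=> u uQ; apply/forall_inP=> v vQ.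
by apply/implyP=> uv; rewrite !ffunE; apply/eqP/jP.
Qed.

Lemma wit_emb_inj (A : finMetricSpace) delta (V : finType) l (e : A -> V) ext :
  witness delta l e ext -> injective e.
Proof.
move=> wP a b eab; have [d0 _ _] := fdist_metric A.
by apply/d0; rewrite -(wit_emb wP) eab (wit_irr wP).
Qed.

Lemma fdist_gt0 (A : finMetricSpace) (a b : A) : (0 < fdist a b) = (a != b).
Proof.
have [d0 _ _] := fdist_metric A; rewrite lt0n; congr (~~ _).
by apply/eqP/eqP => /d0.
Qed.

(** * A first witness, with labels in a cyclic group *)

Section BaseWitness.

Variables (A : finMetricSpace) (delta : nat).
Hypothesis fdist_le : forall a b : A, fdist a b <= delta.

Local Open Scope ring_scope.
Local Notation Z := 'I_delta.+1.
Implicit Types f g h : {ffun A -> option A}.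

(** Each distance is stored once, at the endpoint of smaller rank, so that the two values held by a
    pair add up to its distance. The group is cyclic of order [delta + 1], so every sum is a label
    of size at most [delta]. *)
Definition base_chi (a : A) : {ffun A -> Z} :=
  [ffun b => if (enum_rank a < enum_rank b)%N then inord (fdist a b) else 0].

Definition base_label (u v : A * {ffun A -> Z}) : nat :=
  if u.1 == v.1 then 0%N else nat_of_ord (u.2 v.1 + v.2 u.1).

Lemma base_chiD a b : a != b ->
  base_chi a b + base_chi b a = inord (fdist a b) :> Z.
Proof.
move=> ab; have [_ dC _] := fdist_metric A; rewrite !ffunE.
case: (ltngtP (enum_rank a) (enum_rank b)) => [_|_|/val_inj/enum_rank_inj ab'].
- by rewrite addr0.
- by rewrite add0r dC.
by rewrite ab' eqxx in ab.
Qed.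

Let perm f := pext [set: A] f.

Definition base_diff f (x y : A) : Z :=
  base_chi (perm f x) (perm f y) - base_chi x y.

(** For [x] in the domain the shift is forced by the embedding of [A]. The second branch is then
    forced by the requirement that the shifts at [x, y] and at [y, x] cancel in the label. *)
Definition base_shift f (x y : A) : Z :=
  if x \in pdom f then base_diff f x y
  else if y \in pdom f then - base_diff f y x else 0.

Let full f : partial_automorphism f -> pinjective_in [set: A] f.
Proof.
by move=> fP; split; rewrite ?subsetT //; apply: partial_automorphism_inj.
Qed.

Let perm_coherent : coherent_extension id perm.
Proof.
split=> [f fP|f fP a b|f g h fP gP hP].
- exact/pext_inj/full.
- exact: pext_Some.
by apply: pext_comp; apply: full.
Qed.

(** If both points lie in the domain, the two shifts add up to the change of the distance under [f],
    which is zero; the other cases cancel by construction. *)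
Lemma base_shift_anti f x y : partial_automorphism f -> x != y ->
  base_shift f x y + base_shift f y x = 0.
Proof.
move=> fP xy; rewrite /base_shift.
case: (boolP (x \in pdom f)) => xf; case: (boolP (y \in pdom f)) => yf;
  rewrite ?subrr ?addNr ?addr0 //.
have [[x' fx] [y' fy]] := (pdomP _ _ xf, pdomP _ _ yf).
rewrite /base_diff addrACA -opprD !base_chiD //; last first.
  by apply: contra xy => /eqP/(pext_inj (full fP))/eqP.
by rewrite /perm (pext_Some fx) (pext_Some fy) (fP _ _ _ _ fx fy) subrr.
Qed.

(** A map from [V] to [A] is recorded, rather than a point of [A], because [A] may be empty. *)
Lemma base_witness : exists (V : finType) (l : V -> V -> nat) (e : A -> V) ext,
  [/\ witness delta l e ext & inhabited (V -> A)].
Proof.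
pose flip f (x y : A) (w : Z) := w + base_shift f x y.
exists (A * {ffun A -> Z})%type, base_label, (val_emb id base_chi),
  (val_ext perm perm flip).
have [permI permE permM] := perm_coherent.
have coh : coherent_extension (val_emb id base_chi) (val_ext perm perm flip).
  apply: val_coherent => //.
  - by move=> f x i fP w w' /addIr.
  - move=> f a b i fP fab; rewrite /flip /base_shift (mem_pdom fab).
    by rewrite /base_diff addrC subrK /perm (pext_Some fab).
  move=> f g h fP gP hP fgh x y w /=; rewrite /flip -addrA; congr (_ + _).
  have [dfh rfg rgh eh] := fgh; rewrite /base_shift -dfh.
  have mg z : (perm f z \in pdom g) = (z \in pdom f).
    by apply: (mem_pdom_ext (e := id)) => //; [apply: permI | apply: permE].
  rewrite !mg; have pM := permM _ _ _ fP gP hP fgh.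
  (* Differences of [base_chi] telescope along a pair, its image under [f] and its image under
     [h]. *)
  case: ifP => _; first by rewrite /base_diff !pM /= [RHS]addrC addrA subrK.
  case: ifP => _; last by rewrite addr0.
  by rewrite /base_diff !pM /= -opprD; congr (- _); rewrite [RHS]addrC addrA subrK.
split; last by constructor; exact: fst.
split=> // [f fP u v|u v|u|u v|a b].
- have E1 w : (val_ext perm perm flip f w).1 = perm f w.1 by [].
  rewrite /base_label !E1 (inj_eq (permI f fP)); case: eqP => // /eqP uv.
  by rewrite !(val_ext_act permI) // addrACA base_shift_anti // addr0.
- by rewrite /base_label eq_sym addrC.
- by rewrite /base_label eqxx.
- by rewrite /base_label; case: eqP => // _; rewrite -ltnS ltn_ord.
rewrite /base_label; case: eqP => [/= ->|/= /eqP ab].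
  by apply/esym/eqP; rewrite -leqn0 leqNgt fdist_gt0 eqxx.
by have /(congr1 val) /= -> := base_chiD ab; rewrite inordK // ltnS.
Qed.

End BaseWitness.

Lemma forall_inj (T : finType) (F : T -> T) (P : pred T) :
  injective F -> [forall i, P (F i)] = [forall i, P i].
Proof.
move=> FI; apply/forallP/forallP => PF i //.
by rewrite -(f_finv FI i).
Qed.

(** * Making every clique a copy of a subspace *)

Section CliqueStep.

Variables (A : finMetricSpace) (delta : nat) (V : finType).
Variables (l : V -> V -> nat) (e : A -> V).
Variable ext : {ffun A -> option A} -> V -> V.
Hypothesis wP : witness delta l e ext.
Variable j0 : V -> A.
Implicit Types (f g h : {ffun A -> option A}) (M : {set V}) (a b : A).

Local Notation W := 'I_#|V|.+1.
Local Notation pa := partial_automorphism.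

Let bad M := ~~ clique_maps A l M.
Let eI : injective e := wit_emb_inj wP.
Let extI f (fP : pa f) : injective (ext f).
Proof. by have [H _ _] := wit_ext wP; apply: H. Qed.
Let extE f (fP : pa f) a b : f a = Some b -> ext f (e a) = e b.
Proof. by have [_ H _] := wit_ext wP; apply: H. Qed.

(* A bad set receives one value fewer than it has elements, so it cannot lift
   to a clique. *)
Definition clique_vals M : {set W} := [set w : W | w < #|M|.-1].

Definition clique_chi a : {ffun {set V} -> W} :=
  [ffun M : {set V} => if bad M && (e a \in M)
                       then inord (index (e a) (enum (M :&: e @: A))) else ord0].

Lemma bad_gt1 M : bad M -> 1 < #|M|.
Proof.
apply: contraR; rewrite -leqNgt => /card_le1_eqP M1; apply/clique_mapsP.
by exists j0 => u v uM vM; rewrite (M1 _ _ uM vM) eqxx.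
Qed.

(** If [M] were contained in the image of [A], the inverse of [e] would map it faithfully. So a bad
    set has a vertex outside [A], and one value fewer than [#|M|] still leaves room for distinct
    values on the vertices from [A]. *)
Lemma bad_card M : bad M -> #|M :&: e @: A| <= #|M|.-1.
Proof.
move=> bM; have M0 := ltnW (bad_gt1 bM).
rewrite -ltnS prednK //; apply: proper_card; rewrite properE subsetIl /=.
apply: contra bM => /subsetP sM; apply/clique_mapsP.
pose j u := if [pick a | e a == u] is Some a then a else j0 u.
have ej u : u \in M -> e (j u) = u.
  move=> /sM; rewrite inE => /andP[_ /imsetP[a _ ->]]; rewrite /j.
  by case: pickP => [b /eqP|/(_ a)]; rewrite ?eqxx.
by exists j => u v uM vM _; rewrite -(wit_emb wP) !ej.
Qed.

Lemma clique_chiE M a : bad M -> e a \in M ->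
  clique_chi a M = index (e a) (enum (M :&: e @: A)) :> nat.
Proof.
move=> bM aM; rewrite ffunE bM aM inordK // ltnS.
by apply: leq_trans (index_size _ _) _; rewrite -cardE; apply: max_card.
Qed.

Lemma clique_chi_vals M a : bad M -> e a \in M ->
  clique_chi a M \in clique_vals M.
Proof.
move=> bM aM; rewrite inE clique_chiE //; apply: leq_trans (bad_card bM).
by rewrite cardE index_mem mem_enum inE aM imset_f.
Qed.

Lemma clique_chi_inj M a b : bad M -> e a \in M -> e b \in M ->
  clique_chi a M = clique_chi b M -> a = b.
Proof.
move=> bM aM bbM /(congr1 val) /=; rewrite !clique_chiE // => eq.
have mem c : e c \in M -> e c \in enum (M :&: e @: A).
  by move=> cM; rewrite mem_enum inE cM imset_f.
by apply: eI; rewrite -(nth_index (e a) (mem a aM)) eq nth_index ?mem.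
Qed.

Lemma bad_act f M : pa f -> bad (ext f @: M) = bad M.
Proof.
move=> fP; congr (~~ _).
apply/clique_mapsP/clique_mapsP => -[j jP].
  exists (j \o ext f) => u v uM vM uv /=.
  by rewrite jP ?imset_f ?(inj_eq (extI fP)) // (wit_aut wP).
exists (j \o finv (ext f)) => _ _ /imsetP[u uM ->] /imsetP[v vM ->].
rewrite (inj_eq (extI fP)) => uv /=.
by rewrite !(finv_f (extI fP)) jP // (wit_aut wP).
Qed.

Lemma clique_vals_act f M : pa f -> clique_vals (ext f @: M) = clique_vals M.
Proof.
move=> fP; rewrite /clique_vals card_imset //; exact: extI.
Qed.

(** The part of the permutation of values at [M] that the embedding of [A] prescribes. For bad [M]
    there is at most one candidate to pick, since [clique_chi] separates the points of [A] in
    [M]. *)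
Definition clique_pmap f M : {ffun W -> option W} :=
  [ffun w => [pick w' | [exists a, exists b,
     [&& f a == Some b, e a \in M, clique_chi a M == w
       & clique_chi b (ext f @: M) == w']]]].

Lemma clique_pmapP f M w w' : bad M ->
  clique_pmap f M w = Some w' <->
  exists a b, [/\ f a = Some b, e a \in M, clique_chi a M = w
                & clique_chi b (ext f @: M) = w'].
Proof.
move=> bM; rewrite ffunE; case: pickP => [w1|none].
  case/existsP=> a /existsP[b /and4P[/eqP fab aM /eqP ca /eqP cb]].
  split=> [[<-]|[a' [b' [fab' aM' ca' cb']]]]; first by exists a, b.
  have ea : a' = a by apply: (clique_chi_inj bM) => //; rewrite ca.
  by move: fab'; rewrite ea fab => -[bb]; rewrite -cb bb cb'.
split=> // -[a [b [fab aM ca cb]]]; case/negP: (negbT (none w')).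
apply/existsP; exists a; apply/existsP; exists b.
by rewrite fab aM ca cb !eqxx.
Qed.

Lemma mem_act f M x : pa f -> (ext f x \in ext f @: M) = (x \in M).
Proof. by move=> fP; rewrite mem_imset //; apply: extI. Qed.

Lemma ext_mem f M a b : pa f -> f a = Some b ->
  (e b \in ext f @: M) = (e a \in M).
Proof.
by move=> fP fab; rewrite -(extE fP fab) mem_act.
Qed.

Lemma clique_pmap_inj f M : pa f -> bad M ->
  pinjective_in (clique_vals M) (clique_pmap f M).
Proof.
move=> fP bM; have bF : bad (ext f @: M) by rewrite bad_act.
split.
- move=> w1 w2 w' /(clique_pmapP _ _ _ bM)[a [b [fab aM <- <-]]].
  move=> /(clique_pmapP _ _ _ bM)[a' [b' [fab' aM' <- cb]]].
  have ebb : b' = b.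
    by apply: (clique_chi_inj bF); rewrite ?(ext_mem _ fP fab) ?(ext_mem _ fP fab').
  by rewrite (partial_automorphism_inj fP fab (y := a')) // fab' ebb.
- apply/subsetP=> w /pdomP[w' /(clique_pmapP _ _ _ bM)[a [b [fab aM <- _]]]].
  exact: clique_chi_vals.
apply/subsetP=> w /prangeP[w' /(clique_pmapP _ _ _ bM)[a [b [fab aM _ <-]]]].
by rewrite -(clique_vals_act _ fP) clique_chi_vals // (ext_mem _ fP fab).
Qed.

(** Domain and range of each partial map consist of the values of those points of the domain and
    range of the partial automorphism that lie in [M] or its image, so composability is
    inherited. *)
Lemma clique_pmap_comp f g h M : pa f -> pa g -> pa h -> composable f g h ->
  bad M ->
  composable (clique_pmap f M) (clique_pmap g (ext f @: M)) (clique_pmap h M).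
Proof.
move=> fP gP hP fgh bM; have [dfh rfg rgh eh] := fgh.
have bF : bad (ext f @: M) by rewrite bad_act.
have eM : ext h @: M = ext g @: (ext f @: M).
  by rewrite -imset_comp; apply: eq_imset; have [_ _ H] := wit_ext wP; apply: H.
have step a b : f a = Some b -> exists2 c, g b = Some c & h a = Some c.
  move=> fab; have : b \in pdom g by rewrite -rfg (mem_prange fab).
  by case/pdomP=> c gbc; exists c; rewrite // eh ffunE fab.
have back a c : h a = Some c -> exists2 b, f a = Some b & g b = Some c.
  rewrite eh ffunE; case E: (f a) => [b|] //= gbc; by exists b.
have pull b c : g b = Some c -> exists a, f a = Some b.
  by move=> gbc; apply/prangeP; rewrite rfg (mem_pdom gbc).
split.
- apply/setP=> w; apply/pdomP/pdomP => -[w' /(clique_pmapP _ _ _ bM)].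
    move=> [a [b [fab aM cw _]]]; have [c gbc hac] := step _ _ fab.
    by exists (clique_chi c (ext h @: M)); apply/clique_pmapP => //; exists a, c.
  move=> [a [c [/back[b fab gbc] aM cw _]]].
  by exists (clique_chi b (ext f @: M)); apply/clique_pmapP => //; exists a, b.
- apply/setP=> w; apply/prangeP/pdomP => -[w'].
    move=> /(clique_pmapP _ _ _ bM)[a [b [fab aM _ cw]]].
    have [c gbc hac] := step _ _ fab.
    exists (clique_chi c (ext h @: M)); apply/clique_pmapP => //.
    by exists b, c; rewrite (ext_mem _ fP fab) eM.
  move=> /(clique_pmapP _ _ _ bF)[b [c [gbc bbM cw _]]].
  have [a fab] := pull _ _ gbc.
  exists (clique_chi a M); apply/clique_pmapP => //; exists a, b.
  by rewrite -(ext_mem _ fP fab).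
- apply/setP=> w; apply/prangeP/prangeP => -[w'].
    move=> /(clique_pmapP _ _ _ bF)[b [c [gbc bbM _ cw]]].
    have [a fab] := pull _ _ gbc; have [c' gbc' hac] := step _ _ fab.
    have ecc : c' = c by move: gbc'; rewrite gbc => -[].
    rewrite ecc in hac.
    exists (clique_chi a M); apply/clique_pmapP => //; exists a, c.
    by rewrite -(ext_mem _ fP fab) eM.
  move=> /(clique_pmapP _ _ _ bM)[a [c [/back[b fab gbc] aM _ cw]]].
  exists (clique_chi b (ext f @: M)); apply/clique_pmapP => //.
  by exists b, c; rewrite (ext_mem _ fP fab) -eM.
apply/ffunP=> w; rewrite [RHS]ffunE.
case E: (clique_pmap f M w) => [w'|] /=.
  move/(clique_pmapP _ _ _ bM): E => [a [b [fab aM cw <-]]].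
  have [c gbc hac] := step _ _ fab.
  have -> : clique_pmap h M w = Some (clique_chi c (ext h @: M)).
    by apply/clique_pmapP => //; exists a, c.
  apply/esym/clique_pmapP => //; exists b, c.
  by rewrite (ext_mem _ fP fab) eM.
case E': (clique_pmap h M w) => [w'|] //.
move/(clique_pmapP _ _ _ bM): E' => [a [c [/back[b fab gbc] aM cw _]]].
suff: clique_pmap f M w = Some (clique_chi b (ext f @: M)) by rewrite E.
by apply/clique_pmapP => //; exists a, b.
Qed.

(** The permutation is the same for all [x] in [M], so distinct values of two vertices over [M] stay
    distinct. *)
Definition clique_flip f (x : V) M : W -> W :=
  if bad M && (x \in M) then pext (clique_vals M) (clique_pmap f M) else id.

Definition clique_compatible (u v : V * {ffun {set V} -> W}) : bool :=
  [forall M : {set V}, [&& bad M, u.1 \in M & v.1 \in M] ==>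
     [&& u.2 M != v.2 M, u.2 M \in clique_vals M & v.2 M \in clique_vals M]].

Definition clique_label (u v : V * {ffun {set V} -> W}) : nat :=
  if clique_compatible u v then l u.1 v.1 else 0.

Lemma clique_step :
  exists (V' : finType) (l' : V' -> V' -> nat) (e' : A -> V') ext',
  witness delta l' e' ext' /\ (forall Q, clique l' Q -> clique_maps A l' Q).
Proof.
pose act f M := ext f @: M.
have actI f : pa f -> injective (act f) by move=> fP; apply/imset_inj/extI.
exists (V * {ffun {set V} -> W})%type, clique_label, (val_emb e clique_chi),
  (val_ext ext act clique_flip).
have flipI f x M : pa f -> injective (clique_flip f x M).
  move=> fP; rewrite /clique_flip; case: ifP => [/andP[bM _]|_]; last exact: inj_id.
  exact/pext_inj/clique_pmap_inj.
split; first split=> //.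
- apply: val_coherent => //; first exact: wit_ext wP.
  + move=> f g h fP gP hP fgh M; rewrite /act /= -imset_comp.
    by apply: eq_imset; have [_ _ H] := wit_ext wP; apply: H.
  + move=> f a b M fP fab; rewrite /clique_flip.
    case: ifP => [/andP[bM aM]|nM]; last first.
      by rewrite !ffunE nM bad_act // (ext_mem _ fP fab) nM.
    by apply: pext_Some; apply/clique_pmapP => //; exists a, b.
  move=> f g h fP gP hP fgh x M w; rewrite /clique_flip /act bad_act //.
  rewrite (mem_act M x fP).
  case: (boolP (bad M && (x \in M))) => [/andP[bM xM]|_]; last by [].
  rewrite clique_vals_act; last by [].
  apply: (pext_comp (f := clique_pmap f M)).
  + exact: clique_pmap_inj.
  + by rewrite -(clique_vals_act M fP); apply: clique_pmap_inj; rewrite ?bad_act.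
  exact: clique_pmap_comp.
- move=> f fP u v; rewrite /clique_label (wit_aut wP) //; congr (if _ then _ else _).
  rewrite /clique_compatible -(forall_inj _ (actI f fP)).
  apply: eq_forallb => M; rewrite !(val_ext_act actI) //.
  rewrite bad_act // !mem_act // clique_vals_act //.
  rewrite /clique_flip; case: (boolP (bad M)) => //= bM.
  case: (boolP (u.1 \in M)) => //= uM; case: (boolP (v.1 \in M)) => //= vM.
  have pP := clique_pmap_inj fP bM.
  by rewrite (inj_eq (pext_inj pP)) !(pext_mem _ pP).
- move=> u v; rewrite /clique_label (wit_sym wP); congr (if _ then _ else _).
  apply: eq_forallb => M; rewrite eq_sym.
  by congr (_ ==> _); [congr (_ && _) | congr (_ && _)]; rewrite andbC.
- by move=> u; rewrite /clique_label (wit_irr wP); case: ifP.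
- by move=> u v; rewrite /clique_label; case: ifP => // _; apply: wit_le wP _ _.
- move=> a b; rewrite /clique_label /= (wit_emb wP).
  case: (eqVneq a b) => [->|ab].
    have [d0 _ _] := fdist_metric A.
    by rewrite (_ : fdist b b = 0) ?if_same //; apply/d0.
  suff -> : clique_compatible (val_emb e clique_chi a) (val_emb e clique_chi b) by [].
  apply/forallP=> M; apply/implyP=> /and3P[/= bM aM bbM].
  rewrite !clique_chi_vals // !andbT; apply: contra ab => /eqP.
  by move/(clique_chi_inj bM aM bbM)/eqP.
move=> Q cQ; pose M := fst @: Q.
have lQ u v : u \in Q -> v \in Q -> u != v ->
    clique_compatible u v /\ 0 < l u.1 v.1.
  by move=> uQ vQ uv; have := cQ u v uQ vQ uv; rewrite /clique_label; case: ifP.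
have fI : {in Q &, injective fst}.
  move=> u v uQ vQ uv; apply/eqP; apply: contraT => /(lQ u v uQ vQ)[_].
  by rewrite uv (wit_irr wP).
have cM : #|M| = #|Q| by apply: card_in_imset.
have [/negPn/clique_mapsP[j jP]|bM] := boolP (~~ bad M).
  apply/clique_mapsP; exists (j \o fst) => u v uQ vQ uv /=.
  have [uvC luv] := lQ u v uQ vQ uv; rewrite jP ?imset_f //.
    by rewrite /clique_label uvC.
  by apply: contraL luv => /eqP->; rewrite (wit_irr wP).
move/negPn: bM => bM; have M1 := bad_gt1 bM.
have com u v : u \in Q -> v \in Q -> u != v ->
    [&& u.2 M != v.2 M, u.2 M \in clique_vals M & v.2 M \in clique_vals M].
  move=> uQ vQ uv; have [/forallP/(_ M)/implyP H _] := lQ u v uQ vQ uv.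
  by apply: H; rewrite bM !imset_f.
pose val2 (u : V * {ffun {set V} -> W}) := u.2 M.
(* Pigeonhole: the lifts would carry [#|M|] distinct values among [#|M| - 1]. A vertex has its value
   in [clique_vals M] by compatibility with a second vertex, which exists because bad sets have at
   least two elements. *)
have : #|val2 @: Q| <= #|clique_vals M|.
  apply: subset_leq_card; apply/subsetP=> _ /imsetP[u uQ ->].
  have : 0 < #|Q :\ u| by move: M1; rewrite cM (cardsD1 u) uQ.
  case/card_gt0P=> v; rewrite !inE => /andP[vu vQ].
  by case/and3P: (com v u vQ uQ vu) => _ _; rewrite inE; apply.
rewrite card_in_imset -?cM; last first.
  move=> u v uQ vQ uv; apply/eqP; apply: contraT.
  by case/(com u v uQ vQ)/and3P => /eqP.
have : #|clique_vals M| <= #|M|.-1.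
  rewrite cardE -(size_map val) -[X in _ <= X](size_iota 0).
  apply: uniq_leq_size; first by rewrite (map_inj_uniq val_inj) enum_uniq.
  by move=> x /mapP[w]; rewrite mem_enum inE => wM ->; rewrite mem_iota.
by lia.
Qed.

End CliqueStep.

(** * Unwinding bad closed walks *)

Definition adj (V : Type) (l : V -> V -> nat) : rel V := fun u v => 0 < l u v.

Definition cyc_labels (V : Type) (l : V -> V -> nat) (t : seq V) : seq nat :=
  if t is x :: p then pairmap l x (rcons p x) else [::].

Definition labels_in (delta : nat) : pred (seq nat) :=
  all (fun a => 0 < a <= delta).

(** [good_split] glues two closed walks along an edge labelled [c], [good_cat] glues them at a
    vertex, and [good_pair] covers walking an edge back and forth. *)
Record word_class (delta N : nat) (good : pred (seq nat)) : Prop := WordClass {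
  good_rot : forall w1 w2, good (w1 ++ w2) -> good (w2 ++ w1);
  good_split : forall c w1 w2, 0 < c <= delta -> labels_in delta w1 ->
    labels_in delta w2 -> good (c :: w1) -> good (c :: w2) -> good (w1 ++ w2);
  good_cat : forall w1 w2, labels_in delta w1 -> labels_in delta w2 ->
    good w1 -> good w2 -> good (w1 ++ w2);
  good_long : forall w, labels_in delta w -> N < size w -> good w;
  good_pair : forall a, good [:: a; a]
}.

Lemma not_uniqP (T : eqType) (s : seq T) : ~~ uniq s ->
  exists x s1 s2 s3, s = s1 ++ (x :: s2) ++ x :: s3.
Proof.
elim: s => //= x s IHs; rewrite negb_and negbK => /orP[/splitPr[s2 s3]|].
  by exists x, [::], s2, s3.
by move=> /IHs[y [s1 [s2 [s3 ->]]]]; exists y, (x :: s1), s2, s3.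
Qed.

Section ClosedWalks.

Variables (V : eqType) (l : V -> V -> nat).
Hypothesis lC : forall u v, l u v = l v u.

Lemma cyc_labels_cat x p y q :
  cyc_labels l ((x :: p) ++ y :: q) =
  pairmap l x (rcons p y) ++ pairmap l y (rcons q x).
Proof. by rewrite /= rcons_cat -cat_rcons pairmap_cat last_rcons. Qed.

Lemma path_labels delta x p : (forall u v, l u v <= delta) ->
  path (adj l) x p -> labels_in delta (pairmap l x p).
Proof.
move=> ld; elim: p x => //= y p IHp x /andP[xy yp].
by rewrite -/(labels_in _ _) IHp // andbT ld andbT.
Qed.

Variables (delta N : nat) (good : pred (seq nat)).
Hypothesis goodP : word_class delta N good.
Hypothesis l_le : forall u v, l u v <= delta.

Lemma good_cyc_rot t1 t2 :
  good (cyc_labels l (t1 ++ t2)) -> good (cyc_labels l (t2 ++ t1)).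
Proof.
case: t1 t2 => [|x p] [|y q]; rewrite ?cats0 //.
by rewrite !cyc_labels_cat; apply: (good_rot goodP).
Qed.

Lemma cycle_cat t1 t2 : cycle (adj l) (t1 ++ t2) = cycle (adj l) (t2 ++ t1).
Proof. by rewrite -rot_size_cat rot_cycle. Qed.

Section Shorter.

Variable k : nat.
Hypothesis good_lt : forall t, cycle (adj l) t -> 0 < size t < k ->
  good (cyc_labels l t).

Lemma good_repeat x p q : cycle (adj l) ((x :: p) ++ x :: q) ->
  size p + size q + 2 <= k -> good (cyc_labels l ((x :: p) ++ x :: q)).
Proof.
rewrite cyc_labels_cat => /=; rewrite rcons_cat /= -cat_rcons cat_path.
rewrite last_rcons => /andP[xp xq] sz.
apply: (good_cat goodP); try exact: path_labels.
  by apply: (good_lt (t := x :: p)) => //=; lia.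
by apply: (good_lt (t := x :: q)) => //=; lia.
Qed.

(** The chord closes each of the two arcs to a closed walk, which is strictly shorter because the
    other arc has an inner vertex. *)
Lemma good_chord x p y q : cycle (adj l) ((x :: p) ++ y :: q) ->
  0 < l x y -> 0 < size p -> 0 < size q -> size p + size q + 2 <= k ->
  good (cyc_labels l ((x :: p) ++ y :: q)).
Proof.
rewrite cyc_labels_cat => /=; rewrite rcons_cat /= -cat_rcons cat_path.
rewrite last_rcons => /andP[xp yq] xy p0 q0 sz.
have close x' y' p' : 0 < l x' y' -> path (adj l) x' (rcons p' y') ->
    size p' + 2 < k -> good (l x' y' :: pairmap l x' (rcons p' y')).
  move=> xy' xp' sz'; rewrite -cat1s; apply: (good_rot goodP).
  have /= := good_lt (t := x' :: rcons p' y').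
  rewrite -[X in pairmap l x' X]cats1 pairmap_cat /= last_rcons lC; apply.
    by rewrite rcons_path xp' last_rcons /adj lC.
  by rewrite size_rcons; lia.
apply: (good_split goodP (c := l x y)); try exact: path_labels.
- by rewrite xy l_le.
- by apply: close => //; lia.
by rewrite lC; apply: close; rewrite 1?lC //; lia.
Qed.

(** At a repeated vertex the walk falls into two shorter closed walks, both good. *)
Lemma bad_cycle_uniq t : cycle (adj l) t -> size t <= k ->
  ~~ good (cyc_labels l t) -> uniq t.
Proof.
move=> ct st; apply: contraR => /not_uniqP[x [s1 [s2 [s3 et]]]].
rewrite et in ct st *; apply: good_cyc_rot; rewrite -catA.
rewrite cycle_cat -catA in ct; apply: good_repeat => //.
by move: st; rewrite !size_cat /=; lia.
Qed.

End Shorter.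

End ClosedWalks.

(** * Removing the bad cycles of one length *)

Section CycleStep.

Variables (A : finMetricSpace) (delta N : nat) (good : pred (seq nat)).
Hypothesis goodP : word_class delta N good.
Variables (V : finType) (l : V -> V -> nat) (e : A -> V).
Variable ext : {ffun A -> option A} -> V -> V.
Hypothesis wP : witness delta l e ext.
Variable m : nat.
Hypothesis good_lt : forall t, cycle (adj l) t -> 0 < size t < m.+4 ->
  good (cyc_labels l t).
Implicit Types (f g h : {ffun A -> option A}) (t : m.+4.-tuple V) (a b : A).

Local Notation pa := partial_automorphism.
Let eI : injective e := wit_emb_inj wP.
Let extI f (fP : pa f) : injective (ext f).
Proof. by have [H _ _] := wit_ext wP; apply: H. Qed.
Let extE f (fP : pa f) a b : f a = Some b -> ext f (e a) = e b.
Proof. by have [_ H _] := wit_ext wP; apply: H. Qed.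

Definition bad_cycle (t : seq V) : bool :=
  cycle (adj l) t && ~~ good (cyc_labels l t).

Definition is_first (t : seq V) (x : V) : bool :=
  if t is x0 :: _ then x == x0 else false.
Definition is_last (t : seq V) (x : V) : bool :=
  if t is x0 :: p then x == last x0 p else false.

(* A tuple is a cycle together with its distinguished closing edge, across
   which the valuation has to change; rotations give the other choices. *)
Definition closing (t : seq V) (x y : V) : bool :=
  (is_first t x && is_last t y) || (is_last t x && is_first t y).

(** Inside [A] the value changes between the first and the last vertex of [t] exactly when both come
    from [A], so the closing edge is the only twisted one. *)
Definition cycle_chi a : {ffun m.+4.-tuple V -> bool} :=
  [ffun t : m.+4.-tuple V =>
     [&& bad_cycle t, is_first t (e a) & [exists b, is_last t (e b)]]].

(** The cycle has length at least 4, so one of the edges from [y] to the two ends is a chord: the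
    one to [z] if [y] directly follows [x], the one to [x] otherwise. A shortest bad cycle has no
    chord. *)
Lemma bad_no_three t x y z : bad_cycle t -> is_first t x -> is_last t z ->
  y \in tval t -> y != x -> y != z -> 0 < l x y -> 0 < l z y -> False.
Proof.
move=> /andP[ct /negP nt]; case: t ct nt => -[//|x0 p] sz.
rewrite [tval _]/= /is_first /is_last => ct nt /eqP-> /eqP-> {x z}.
rewrite inE => /orP[->//|yp] _ yz xy zy.
case/splitPr: yp ct nt sz yz zy => p1 p2 ct nt sz.
rewrite last_cat /=; case/lastP: p2 => [|p2 z] in ct nt sz *.
  by rewrite eqxx.
rewrite last_rcons => yz zy; have {}sz : size p1 + size p2 + 2 = m.+3.
  by move/eqP: sz; rewrite /= size_cat /= size_rcons; lia.
case: p1 => [|y1 p1] in ct nt sz.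
  apply: nt; rewrite -[x0 :: _]/([:: x0; y] ++ rcons p2 z).
  rewrite -cats1 catA; apply: (good_cyc_rot goodP).
  rewrite -[_ ++ _]/([:: z; x0] ++ y :: p2).
  apply: (good_chord (wit_sym wP) goodP (wit_le wP) good_lt) => //.
  - rewrite -[_ ++ _]/([:: z] ++ [:: x0, y & p2]) cycle_cat.
    by rewrite cats1.
  - by move: sz; rewrite /=; lia.
  by move: sz; rewrite /=; lia.
apply: nt; rewrite -[x0 :: _]/((x0 :: y1 :: p1) ++ y :: rcons p2 z).
apply: (good_chord (wit_sym wP) goodP (wit_le wP) good_lt) => //=.
  by rewrite size_rcons.
by rewrite size_rcons; move: sz => /=; lia.
Qed.

Lemma cycle_chiD t a b : bad_cycle t -> e a \in tval t -> e b \in tval t ->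
  a != b -> cycle_chi a t (+) cycle_chi b t = closing t (e a) (e b).
Proof.
move=> bt; have ut : uniq t.
  case/andP: (bt) => ct nt.
  by apply: (bad_cycle_uniq goodP (wit_le wP) good_lt ct) => //; rewrite size_tuple.
have fl x : is_first t x -> is_last t x -> False.
  case: (t) ut => -[//|x0 [//|x1 p]] _ /= /andP[nx _] /eqP->.
  by move: nx; case: eqP => // ->; rewrite mem_last.
have adjE c c' : c != c' -> 0 < l (e c) (e c').
  by rewrite (wit_emb wP) fdist_gt0.
(* Points of [A] are pairwise adjacent. If both ends of [t] come from [A], a third vertex of [t]
   from [A] would be adjacent to both, against [bad_no_three]. *)
have key c c' : e c' \in tval t -> c != c' ->
    cycle_chi c t = is_first t (e c) && is_last t (e c').
  move=> tc' cc'; rewrite ffunE bt /=.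
  case: (boolP (is_first t (e c))) => //= fc.
  apply/existsP/idP => [[b' lb]|lc]; last by exists c'.
  apply: contraT => nlc; case: (@bad_no_three t (e c) (e c') (e b')) => //.
  - by rewrite (inj_eq eI) eq_sym.
  - by apply: contra nlc => /eqP->.
  - exact: adjE.
  by apply: adjE; apply: contra nlc => /eqP <-.
move=> ta tb ab; rewrite (key a b) // (key b a) 1?eq_sym // /closing.
have := fl (e a); have := fl (e b).
case: (is_first t (e a)); case: (is_first t (e b));
  case: (is_last t (e a)); case: (is_last t (e b)) => // Hb Ha;
  by [case: (Hb isT isT) | case: (Ha isT isT)].
Qed.

Let act f t : m.+4.-tuple V := map_tuple (ext f) t.

Lemma is_first_map f (t : seq V) x : pa f ->
  is_first (map (ext f) t) (ext f x) = is_first t x.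
Proof. by move=> fP; case: t => //= x0 p; rewrite (inj_eq (extI fP)). Qed.

Lemma is_last_map f (t : seq V) x : pa f ->
  is_last (map (ext f) t) (ext f x) = is_last t x.
Proof.
by move=> fP; case: t => //= x0 p; rewrite last_map (inj_eq (extI fP)).
Qed.

Lemma closing_map f (t : seq V) x y : pa f ->
  closing (map (ext f) t) (ext f x) (ext f y) = closing t x y.
Proof. by move=> fP; rewrite /closing !is_first_map ?is_last_map. Qed.

Lemma bad_cycle_map f (t : seq V) : pa f ->
  bad_cycle (map (ext f) t) = bad_cycle t.
Proof.
move=> fP; have pm x p : pairmap l (ext f x) (map (ext f) p) = pairmap l x p.
  by elim: p x => //= y p IHp x; rewrite IHp (wit_aut wP).
have pp x p : path (adj l) (ext f x) (map (ext f) p) = path (adj l) x p.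
  by elim: p x => //= y p IHp x; rewrite IHp /adj (wit_aut wP).
by case: t => //= x p; rewrite /bad_cycle /= -map_rcons pm pp.
Qed.

Definition cycle_flip f t : bool := bad_cycle t &&
  [exists a, exists b, [&& f a == Some b, e a \in tval t
                         & cycle_chi a t (+) cycle_chi b (act f t)]].

Lemma mem_map_ext f t x : pa f -> (ext f x \in tval (act f t)) = (x \in tval t).
Proof. by move=> fP; apply: mem_map; apply: extI. Qed.

(** The discrepancy does not depend on the chosen point: for two points of the domain on [t], the
    difference of values is given by [closing], which is invariant under [ext f]. *)
Lemma cycle_flipE f t a b : pa f -> bad_cycle t -> f a = Some b ->
  e a \in tval t -> cycle_flip f t = cycle_chi a t (+) cycle_chi b (act f t).
Proof.
move=> fP bt fab ta; rewrite /cycle_flip bt /=.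
apply/existsP/idP => [[a' /existsP[b' /and3P[/eqP fab' ta' H]]]|H]; last first.
  by exists a; apply/existsP; exists b; rewrite fab ta H eqxx.
have [aa'|aa'] := eqVneq a a'.
  by move: fab'; rewrite -aa' fab => -[->]; rewrite -aa' in H *.
have bb' : b != b'.
  apply: contra aa' => /eqP bb'; apply/eqP.
  by apply: (partial_automorphism_inj fP fab); rewrite bb'.
have mE c d : f c = Some d -> e c \in tval t -> e d \in tval (act f t).
  by move=> fcd; rewrite -(extE fP fcd) mem_map_ext.
have D1 := cycle_chiD bt ta ta' aa'.
have : bad_cycle (act f t) by rewrite bad_cycle_map.
move/cycle_chiD/(_ (mE _ _ fab ta) (mE _ _ fab' ta') bb').
rewrite -(extE fP fab) -(extE fP fab') closing_map // -D1.
by move: H; do 4!case: (cycle_chi _ _).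
Qed.

(** If the domain of [f] meets [t], the discrepancies telescope along [a], [f a], [h a]. Otherwise
    the domain of [g], being the range of [f], misses the image of [t], and nothing is flipped. *)
Lemma cycle_flipM f g h t : pa f -> pa g -> pa h -> composable f g h ->
  cycle_flip h t = cycle_flip f t (+) cycle_flip g (act f t).
Proof.
move=> fP gP hP fgh; have [dfh rfg rgh eh] := fgh.
have actM : act h t = act g (act f t).
  apply: val_inj; rewrite /= -map_comp; apply: eq_map.
  by have [_ _ H] := wit_ext wP; apply: H.
case: (boolP (bad_cycle t)) => bt; last first.
  by rewrite /cycle_flip bad_cycle_map // (negPf bt).
have bF : bad_cycle (act f t) by rewrite bad_cycle_map.
have [/existsP[a /andP[/pdomP[b fab] ta]]|/existsPn no] :=
    boolP [exists a, (a \in pdom f) && (e a \in tval t)].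
  have : b \in pdom g by rewrite -rfg (mem_prange fab).
  case/pdomP=> c gbc; have hac : h a = Some c by rewrite eh ffunE fab.
  have tb : e b \in tval (act f t) by rewrite -(extE fP fab) mem_map_ext.
  rewrite (cycle_flipE hP bt hac ta) (cycle_flipE fP bt fab ta).
  rewrite (cycle_flipE gP bF gbc tb) -actM addbA.
  by rewrite -[X in _ = X (+) _]addbA addbb addbF.
have flip0 f' t' : (forall a b, f' a = Some b -> e a \notin tval t') ->
    cycle_flip f' t' = false.
  move=> no'; apply/negP=> /andP[_ /existsP[a /existsP[b /and3P[/eqP fab ta _]]]].
  by have := no' _ _ fab; rewrite ta.
have nof a b : f a = Some b -> e a \notin tval t.
  by move=> fab; have := no a; rewrite (mem_pdom fab).
rewrite !flip0 // => a b ab.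
  have /prangeP[c fca] : a \in prange f by rewrite rfg (mem_pdom ab).
  by rewrite -(extE fP fca) mem_map_ext //; apply: nof fca.
by have := no a; rewrite dfh (mem_pdom ab).
Qed.

Definition cycle_compatible (u v : V * {ffun m.+4.-tuple V -> bool}) : bool :=
  [forall t : m.+4.-tuple V,
     [&& bad_cycle t, u.1 \in tval t & v.1 \in tval t] ==>
     (u.2 t (+) v.2 t == closing t u.1 v.1)].

Definition cycle_label (u v : V * {ffun m.+4.-tuple V -> bool}) : nat :=
  if cycle_compatible u v then l u.1 v.1 else 0.

Lemma adj_cycle_label u v : adj cycle_label u v ->
  cycle_compatible u v /\ cycle_label u v = l u.1 v.1.
Proof. by rewrite /adj /cycle_label; case: ifP. Qed.

(** Along a lift the value at [t] is constant over all edges but the closing one, hence equal at the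
    two ends, whereas the closing edge demands different values. *)
Lemma bad_cycle_no_lift (s : seq (V * {ffun m.+4.-tuple V -> bool})) t :
  tval t = map fst s -> cycle (adj cycle_label) s -> bad_cycle t -> False.
Proof.
move=> ts cs bt; have /andP[ct nt] := bt.
have ut : uniq t.
  by apply: (bad_cycle_uniq goodP (wit_le wP) good_lt ct) => //; rewrite size_tuple.
have : size s = m.+4 by rewrite -(size_map fst) -ts size_tuple.
case: s => // u p in ts cs * => -[sp].
have st : size (u :: p) = m.+4 by rewrite /= sp.
pose c (v : V * {ffun m.+4.-tuple V -> bool}) := v.2 t.
have step v w : v \in u :: p -> w \in u :: p -> adj cycle_label v w ->
    c v (+) c w = closing t v.1 w.1.
  move=> vp wp /adj_cycle_label[/forallP/(_ t)/implyP H _]; apply/eqP/H.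
  by rewrite bt ts !map_f.
move: cs; rewrite /= rcons_path => /andP[up lu].
have nthE i : i < m.+4 -> (nth u (u :: p) i).1 = nth u.1 t i.
  by move=> im; rewrite ts (nth_map u) // st.
have cst i : i < m.+4 -> c (nth u (u :: p) i) = c u.
  elim: i => // i IHi im.
  have ip : i < size p by rewrite sp.
  rewrite -IHi; last exact: ltnW.
  have := step (nth u (u :: p) i) (nth u p i).
  rewrite mem_nth ?st 1?ltnW // inE mem_nth ?orbT // => /(_ isT isT).
  move/(pathP u): up => /(_ _ ip) up /(_ up).
  have -> : closing t (nth u (u :: p) i).1 (nth u p i).1 = false.
    rewrite -[nth u p i]/(nth u (u :: p) i.+1) !nthE // 1?ltnW //.
    have E : tval t = u.1 :: map fst p by rewrite ts.
    have FE x : is_first t x = (x == nth u.1 t 0) by rewrite E.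
    have LE x : is_last t x = (x == nth u.1 t m.+3).
      by rewrite E /= (last_nth u.1) size_map sp.
    have im' := ltnW im; rewrite /closing !FE !LE.
    rewrite !(nth_uniq u.1 _ _ ut) ?size_tuple //.
    by rewrite andbF orbF; case: (i).
  move: (nth u (u :: p) i) => v; rewrite -[nth _ _ i.+1]/(nth u p i).
  by case: (c v); case: (c (nth u p i)).
have := step (last u p) u; rewrite mem_last mem_head => /(_ isT isT lu).
have -> : c (last u p) = c u by rewrite (last_nth u) sp cst.
by rewrite addbb /closing ts /= last_map !eqxx orbT.
Qed.

Lemma cycle_step : (forall Q, clique l Q -> clique_maps A l Q) ->
  exists (V' : finType) (l' : V' -> V' -> nat) (e' : A -> V') ext',
  [/\ witness delta l' e' ext', forall Q, clique l' Q -> clique_maps A l' Q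
    & forall s, cycle (adj l') s -> 0 < size s < m.+4.+1 ->
        good (cyc_labels l' s)].
Proof.
move=> clP; have actI f : pa f -> injective (act f).
  by move=> fP t t' /(congr1 val) /= /(inj_map (extI fP)) /val_inj.
(* All vertices on [t] are flipped together, so differences of values on [t] are preserved. *)
pose flip f x t w := w (+) ((x \in tval t) && cycle_flip f t).
exists (V * {ffun m.+4.-tuple V -> bool})%type, cycle_label,
  (val_emb e cycle_chi), (val_ext ext act flip).
split; first split=> //.
- apply: val_coherent => //; first exact: wit_ext wP.
  + move=> f g h fP gP hP fgh t; apply: val_inj.
    rewrite /= -map_comp; apply: eq_map.
    by have [_ _ H] := wit_ext wP; apply: H.
  + by move=> f x t fP w w'; rewrite /flip; apply: addIb.
  + move=> f a b t fP fab; rewrite /flip.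
    have [ta|ta] := boolP (e a \in tval t); last first.
      have nF (t' : seq V) y : y \notin t' -> is_first t' y = false.
        by case: t' => //= y0 p; rewrite inE; case: eqP.
      have tb : e b \notin tval (act f t) by rewrite -(extE fP fab) mem_map_ext.
      by rewrite !ffunE !nF // !andbF.
    have [bt|bt] := boolP (bad_cycle t).
      by rewrite (cycle_flipE fP bt fab ta) addKb.
    by rewrite /cycle_flip !ffunE bad_cycle_map // (negPf bt).
  move=> f g h fP gP hP fgh x t w; rewrite /flip /= mem_map_ext //.
  rewrite (cycle_flipM t fP gP hP fgh).
  by case: (x \in tval t) => //=; rewrite ?addbF // addbA.
- move=> f fP u v; rewrite /cycle_label (wit_aut wP) //; congr (if _ then _ else _).
  rewrite /cycle_compatible -(forall_inj _ (actI f fP)).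
  apply: eq_forallb => t; rewrite !(val_ext_act actI) //.
  rewrite bad_cycle_map // !mem_map_ext // closing_map // /flip.
  case: (boolP (u.1 \in tval t)) => uT; rewrite ?andbF //.
  case: (boolP (v.1 \in tval t)) => vT; rewrite ?andbF //.
  by congr (_ ==> (_ == _)); rewrite /= addbACA addbb addbF.
- move=> u v; rewrite /cycle_label (wit_sym wP); congr (if _ then _ else _).
  apply: eq_forallb => t; rewrite [_ (+) _]addbC /closing.
  rewrite [is_first t u.1 && _]andbC [is_last t u.1 && _]andbC.
  by rewrite [in RHS]orbC [in LHS](andbC (u.1 \in _)).
- by move=> u; rewrite /cycle_label (wit_irr wP); case: ifP.
- by move=> u v; rewrite /cycle_label; case: ifP => // _; apply: wit_le wP _ _.
- move=> a b; rewrite /cycle_label /= (wit_emb wP).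
  case: (eqVneq a b) => [->|ab].
    have [d0 _ _] := fdist_metric A.
    by rewrite (_ : fdist b b = 0) ?if_same //; apply/d0.
  suff -> : cycle_compatible (val_emb e cycle_chi a) (val_emb e cycle_chi b) by [].
  by apply/forallP=> t; apply/implyP=> /and3P[/= bt ta tb]; rewrite cycle_chiD.
- move=> Q cQ; have lQ u v : u \in Q -> v \in Q -> u != v ->
      cycle_label u v = l u.1 v.1 /\ 0 < l u.1 v.1.
    move=> uQ vQ uv; have := cQ u v uQ vQ uv => luv.
    by have [_ E] := adj_cycle_label luv; rewrite -E.
  have /clP/clique_mapsP[j jP] : clique l (fst @: Q).
    move=> _ _ /imsetP[u uQ ->] /imsetP[v vQ ->] uv.
    have : u != v by apply: contra uv => /eqP->.
    by case/(lQ u v uQ vQ).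
  apply/clique_mapsP; exists (j \o fst) => u v uQ vQ uv /=.
  have [-> luv] := lQ u v uQ vQ uv; rewrite jP ?imset_f //.
  by apply: contraL luv => /eqP->; rewrite (wit_irr wP).
move=> s cs ss.
have proj x p : path (adj cycle_label) x p ->
    path (adj l) x.1 (map fst p) /\
    pairmap cycle_label x p = pairmap l x.1 (map fst p).
  elim: p x => //= y p IHp x /andP[xy /IHp[-> ->]].
  by have [_ E] := adj_cycle_label xy; rewrite E andbT /adj -E.
have [cs' ->] : cycle (adj l) (map fst s) /\
    cyc_labels cycle_label s = cyc_labels l (map fst s).
  case: s cs {ss} => //= u p /proj; rewrite map_rcons => -[? ->].
  by [].
have [sm|sm] := ltnP (size s) m.+4.
  by apply: good_lt; rewrite ?size_map ?sm ?andbT //; case/andP: ss.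
apply: contraT => nt.
have st : size (map fst s) == m.+4.
  by rewrite size_map eqn_leq sm andbT -ltnS; case/andP: ss.
by case: (@bad_cycle_no_lift s (Tuple st)) => //; rewrite /bad_cycle /= cs' nt.
Qed.

End CycleStep.

(* Cliques are made faithful first, so that closed walks of length 3 are
   copies of triangles of [A]; longer bad walks are then removed by length. *)
Theorem unwinding (A : finMetricSpace) (delta N : nat) (good : pred (seq nat)) :
  word_class delta N good -> (forall a b : A, fdist a b <= delta) ->
  (forall x y z : A, x != y -> y != z -> z != x ->
     good [:: fdist x y; fdist y z; fdist z x]) ->
  exists (V : finType) (l : V -> V -> nat) (e : A -> V) ext,
  [/\ witness delta l e ext, forall Q, clique l Q -> clique_maps A l Q
    & forall t, cycle (adj l) t -> 0 < size t -> good (cyc_labels l t)].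
Proof.
move=> goodP dle good3.
suff [V [l [e [ext [wP clP gl]]]]] :
    exists (V : finType) (l : V -> V -> nat) (e : A -> V) ext,
    [/\ witness delta l e ext, forall Q, clique l Q -> clique_maps A l Q
      & forall t, cycle (adj l) t -> 0 < size t < N.+4 -> good (cyc_labels l t)].
  exists V, l, e, ext; split=> // t ct t0.
  have [tN|tN] := ltnP (size t) N.+4; first by apply: gl; rewrite ?t0.
  apply: (good_long goodP).
    by case: t ct {t0 tN} => //= x p; apply: path_labels (wit_le wP).
  by case: t t0 tN {ct} => //= x p _; rewrite size_pairmap size_rcons; lia.
have [V0 [l0 [e0 [ext0 [wP0 [j0]]]]]] := base_witness dle.
have [V1 [l1 [e1 [ext1 [wP1 cl1]]]]] := clique_step wP0 j0.
elim: (N) => [|n [V [l [e [ext [wP clP gl]]]]]]; last first.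
  exact: (cycle_step goodP wP gl clP).
(* Closed walks of length 1 do not exist, those of length 2 run along one edge and back, and those
   of length 3 are cliques. *)
exists V1, l1, e1, ext1; split=> // -[|x [|y [|z [|w t]]]] //=.
- by rewrite /adj (wit_irr wP1).
- by move=> _ _; rewrite (wit_sym wP1 y x); apply: (good_pair goodP).
case/and4P=> xy yz zx _ _.
have neq u v : adj l1 u v -> u != v.
  by apply: contraL => /eqP->; rewrite /adj (wit_irr wP1).
have : clique l1 [set x; y; z].
  move=> u v; rewrite !inE => /orP[/orP[]|] /eqP-> /orP[/orP[]|] /eqP-> //;
    rewrite ?eqxx // => _; by rewrite // (wit_sym wP1).
case/cl1/clique_mapsP=> j jP.
have jE u v : adj l1 u v -> u \in [set x; y; z] -> v \in [set x; y; z] ->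
    fdist (j u) (j v) = l1 u v.
  by move=> uv uS vS; apply: jP => //; apply: neq.
have jN u v : adj l1 u v -> fdist (j u) (j v) = l1 u v -> j u != j v.
  by move=> uv E; rewrite -fdist_gt0 E.
have [jxy jyz jzx] : [/\ fdist (j x) (j y) = l1 x y, fdist (j y) (j z) = l1 y z
    & fdist (j z) (j x) = l1 z x].
  by split; apply: jE; rewrite // !inE eqxx ?orbT.
by rewrite -jxy -jyz -jzx; apply: good3; apply: jN.
Qed.

(** * Marked words and walks *)

(* [marking w k x r]: some [k] letters of [w] are marked, they sum to [x], and
   the remaining letters sum to [r]. *)
Inductive marking : seq nat -> nat -> nat -> nat -> Prop :=
| MarkNil : marking [::] 0 0 0
| MarkOff a w k x r : marking w k x r -> marking (a :: w) k x (a + r)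
| MarkOn a w k x r : marking w k x r -> marking (a :: w) k.+1 (a + x) r.

Lemma marking_cat w1 w2 k1 x1 r1 k2 x2 r2 :
  marking w1 k1 x1 r1 -> marking w2 k2 x2 r2 ->
  marking (w1 ++ w2) (k1 + k2) (x1 + x2) (r1 + r2).
Proof.
move=> + m2; elim=> [|a w k x r _ IH|a w k x r _ IH] //.
  by rewrite cat_cons -addnA; apply: MarkOff.
by rewrite cat_cons addSn -addnA; apply: MarkOn.
Qed.

Lemma marking_split w1 w2 k x r : marking (w1 ++ w2) k x r ->
  exists k1 x1 r1 k2 x2 r2, [/\ marking w1 k1 x1 r1, marking w2 k2 x2 r2,
    k = k1 + k2, x = x1 + x2 & r = r1 + r2].
Proof.
elim: w1 k x r => [|a w1 IH] k x r mw.
  by exists 0, 0, 0, k, x, r; split=> //; apply: MarkNil.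
move: mw; rewrite cat_cons; move E: (a :: _) => w mw.
case: mw E => // [a' w' k' x' r'|a' w' k' x' r'] mw [-> E].
  move: mw; rewrite -E => /IH[k1 [x1 [r1 [k2 [x2 [r2 [m1 m2 -> -> ->]]]]]]].
  by exists k1, x1, (a' + r1), k2, x2, r2; split; rewrite ?addnA //; apply: MarkOff.
move: mw; rewrite -E => /IH[k1 [x1 [r1 [k2 [x2 [r2 [m1 m2 -> -> ->]]]]]]].
by exists k1.+1, (a' + x1), r1, k2, x2, r2; split; rewrite ?addnA //; apply: MarkOn.
Qed.

Lemma marking_cons a w k x r : marking (a :: w) k x r ->
  (exists2 r', r = a + r' & marking w k x r') \/
  (exists k' x', [/\ k = k'.+1, x = a + x' & marking w k' x' r]).
Proof.
move E: (a :: w) => w' mw.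
case: mw E => // [a' w1 k' x' r'|a' w1 k' x' r'] mw [-> ->].
  by left; exists r'.
by right; exists k', x'.
Qed.

Lemma marking_sum w k x r : marking w k x r -> x + r = sumn w.
Proof. by elim=> //= a w' k' x' r' _ <-; lia. Qed.

Lemma marking_off w : marking w 0 0 (sumn w).
Proof. by elim: w => [|a w IH]; [apply: MarkNil | apply: MarkOff]. Qed.

Lemma marking_le delta w k x r : labels_in delta w -> marking w k x r ->
  x <= k * delta.
Proof.
move=> + mw; elim: mw => //= a w' k' x' r' _ IH /andP[aP /IH]; first by [].
by rewrite mulSn; lia.
Qed.

Lemma marking_size delta w k x r : labels_in delta w -> marking w k x r ->
  size w <= k + r.
Proof.
by move=> + mw; elim: mw => //= a w' k' x' r' _ IH /andP[aP /IH]; lia.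
Qed.

(** Letter by letter: an unmarked letter is at least 1, and a marked one is at most [delta], hence
    at most [E/2 - 1]. *)
Lemma marking_cost delta E w k x r : 2 * delta + 2 <= E ->
  labels_in delta w -> marking w k x r -> 2 * size w + 2 * x <= 2 * r + k * E.
Proof.
move=> dE + mw; elim: mw => //= a w' k' x' r' _ IH /andP[aP /IH]; first by lia.
by rewrite mulSn; lia.
Qed.

Section MarkedWalks.

Variables (V : eqType) (l : V -> V -> nat).
Hypothesis lC : forall u v, l u v = l v u.

Definition mwalk (u v : V) (n k x r : nat) : Prop :=
  exists2 p, path (adj l) u p & [/\ last u p = v, size p = n
                                 & marking (pairmap l u p) k x r].

Lemma mwalk_cat u v w n1 k1 x1 r1 n2 k2 x2 r2 :
  mwalk u v n1 k1 x1 r1 -> mwalk v w n2 k2 x2 r2 ->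
  mwalk u w (n1 + n2) (k1 + k2) (x1 + x2) (r1 + r2).
Proof.
case=> p up [<- <- m1] [q vq [<- <- m2]]; exists (p ++ q).
  by rewrite cat_path up.
by rewrite last_cat size_cat pairmap_cat; split=> //; apply: marking_cat.
Qed.

Lemma mwalk_nil u : mwalk u u 0 0 0 0.
Proof. by exists [::] => //; split=> //; apply: MarkNil. Qed.

Lemma mwalk_off u v : 0 < l u v -> mwalk u v 1 0 0 (l u v).
Proof.
move=> uv; exists [:: v]; rewrite /= /adj ?uv //; split=> //.
by rewrite -[X in marking _ _ _ X]addn0; apply/MarkOff/MarkNil.
Qed.

Lemma mwalk_on u v : 0 < l u v -> mwalk u v 1 1 (l u v) 0.
Proof.
move=> uv; exists [:: v]; rewrite /= /adj ?uv //; split=> //.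
by rewrite -[X in marking _ _ X _]addn0; apply/MarkOn/MarkNil.
Qed.

Lemma mwalk_rev u v n k x r : mwalk u v n k x r -> mwalk v u n k x r.
Proof.
case=> p; elim: p u v n k x r => [|y p IH] u v n k x r.
  move=> _ [/= <- <-]; move E: [::] => w mw.
  by case: mw E => // _; apply: mwalk_nil.
move=> /= /andP[uy yp] [<- <-]; have yu : 0 < l y u by rewrite lC.
case/marking_cons=> [[r' -> mw]|[k' [x' [-> -> mw]]]].
  have IHp : mwalk (last y p) y (size p) k x r' by apply: IH yp _.
  have := mwalk_cat IHp (mwalk_off yu).
  by rewrite addn1 !addn0 addnC lC.
have IHp : mwalk (last y p) y (size p) k' x' r by apply: IH yp _.
have := mwalk_cat IHp (mwalk_on yu).
by rewrite !addn1 !addn0 addnC lC.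
Qed.

Variable delta : nat.
Hypothesis l_le : forall u v, l u v <= delta.

Lemma mwalk_le u v n k x r : mwalk u v n k x r -> x <= k * delta.
Proof. by case=> p up [_ _]; apply: marking_le; apply: path_labels up. Qed.

Lemma mwalk_size u v n k x r : mwalk u v n k x r -> n <= k + r.
Proof.
case=> p up [_ <- mw]; rewrite -(size_pairmap l u).
by apply: marking_size mw; apply: path_labels up.
Qed.

Lemma mwalk_cost E u v n k x r : 2 * delta + 2 <= E ->
  mwalk u v n k x r -> 2 * n + 2 * x <= 2 * r + k * E.
Proof.
move=> dE [p up [_ <- mw]]; rewrite -(size_pairmap l u).
by apply: (marking_cost dE _ mw); apply: path_labels up.
Qed.

Lemma mwalk_gt0 u v n k x r : u != v -> mwalk u v n k x r -> 0 < n.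
Proof. by move=> uv [[|y p] _ [/= E <- _]] //; rewrite E eqxx in uv. Qed.

Lemma mwalk_gt1 u v n k x r : u != v -> l u v = 0 -> mwalk u v n k x r -> 1 < n.
Proof.
move=> uv luv [[|y [|z p]] up [/= E <- _]] //; first by rewrite E eqxx in uv.
by move: up; rewrite /= E /adj luv.
Qed.

(** Goodness speaks of non-empty closed walks only; the premise [P 0 0 0] supplies the trivial
    one. *)
Lemma mwalk_closed (good : pred (seq nat)) (P : nat -> nat -> nat -> Prop) :
  (forall t, cycle (adj l) t -> 0 < size t -> good (cyc_labels l t)) ->
  (forall w k x r, labels_in delta w -> good w -> marking w k x r -> P k x r) ->
  P 0 0 0 -> forall u n k x r, mwalk u u n k x r -> P k x r.
Proof.
move=> gl gP P0 u n k x r [p up [E _ mw]].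
case/lastP: p => [|p v] in up E mw.
  by move: mw; move E': (pairmap _ _ _) => w mw; case: mw E' => //.
rewrite last_rcons in E; rewrite {}E in up mw.
by apply: gP mw; [exact: path_labels up | exact: (gl (u :: p))].
Qed.

End MarkedWalks.

Lemma mwalk_map (V : eqType) (l : V -> V -> nat) (F : V -> V) :
  (forall u v, l (F u) (F v) = l u v) ->
  forall u v n k x r, mwalk l u v n k x r -> mwalk l (F u) (F v) n k x r.
Proof.
move=> lF u v n k x r [p up [<- <- mw]]; exists (map F p).
  by elim: p u up {mw} => //= y p IH u /andP[uy /IH->]; rewrite /adj lF andbT.
rewrite last_map size_map; split=> //.
have -> // : pairmap l (F u) (map F p) = pairmap l u p.
by elim: p u {up mw} => //= y p IH u; rewrite IH lF.
Qed.

Lemma mwalk_aut (V : finType) (l : V -> V -> nat) (F : V -> V) :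
  injective F -> (forall u v, l (F u) (F v) = l u v) ->
  forall u v n k x r, mwalk l (F u) (F v) n k x r <-> mwalk l u v n k x r.
Proof.
move=> FI lF u v n k x r; split; last exact: mwalk_map.
have lG u' v' : l (finv F u') (finv F v') = l u' v'.
  by rewrite -lF !(f_finv FI).
by move/(mwalk_map lG); rewrite !(finv_f FI).
Qed.

(** * Clamped completion *)

(* [t] is [m] clamped to the interval between the lower bounds [Lo] and the
   upper bounds [Up]. *)
Definition clamped (Up Lo : nat -> Prop) (m t : nat) : Prop :=
  [/\ forall s, Up s -> t <= s, forall s, Lo s -> s <= t,
      t < m -> Up t & m < t -> Lo t].

(** The value is the least upper bound if one lies below [m], else the greatest lower bound if one
    lies above [m], else [m] itself. *)
Lemma clamped_exists (Up Lo : nat -> Prop) (m B : nat) :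
  (forall s t, Lo s -> Up t -> s <= t) -> (forall s, Lo s -> s <= B) ->
  exists t, clamped Up Lo m t.
Proof.
move=> LU LB; have [[s [Us sm]]|noU] := EM (exists s, Up s /\ s < m).
  have ex : exists s, `[< Up s >] by exists s; apply/asboolP.
  case: (ex_minnP ex) => t /asboolP Ut tmin; exists t; split=> //.
  - by move=> s' /asboolP; apply: tmin.
  - by move=> s' Ls'; apply: LU Ut.
  by have := tmin s (asboolT Us); lia.
have [[s [Ls sm]]|noL] := EM (exists s, Lo s /\ m < s).
  have ex : exists s, `[< Lo s >] by exists s; apply/asboolP.
  have bd s' : `[< Lo s' >] -> s' <= B by move/asboolP/LB.
  case: (ex_maxnP ex bd) => t /asboolP Lt tmax; exists t; split=> //.
  - by move=> s' Us'; apply: LU Us'.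
  - by move=> s' /asboolP; apply: tmax.
  by have := tmax s (asboolT Ls); lia.
exists m; split=> [s Us|s Ls||]; rewrite ?ltnn //.
  by rewrite leqNgt; apply/negP => sm; apply: noU; exists s.
by rewrite leqNgt; apply/negP => sm; apply: noL; exists s.
Qed.

Lemma clamped_unique (Up Lo : nat -> Prop) (m s t : nat) :
  clamped Up Lo m s -> clamped Up Lo m t -> s = t.
Proof.
suff le s' t' : clamped Up Lo m s' -> clamped Up Lo m t' -> s' <= t'.
  by move=> cs ct; apply/eqP; rewrite eqn_leq !le.
move=> [U1 L1 u1 l1] [U2 L2 u2 l2]; rewrite leqNgt; apply/negP=> ts.
have [tm|mt] := ltnP t' m; first by have := U1 _ (u2 tm); lia.
by have := L2 _ (l1 (leq_ltn_trans mt ts)); lia.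
Qed.

Lemma clamped_eq (Up Lo Up' Lo' : nat -> Prop) (m t : nat) :
  (forall s, Up s <-> Up' s) -> (forall s, Lo s <-> Lo' s) ->
  clamped Up Lo m t -> clamped Up' Lo' m t.
Proof.
move=> eU eL [U L u l]; split=> [s /eU/U|s /eL/L|/u/eU|/l/eL] //.
Qed.

(** Avoiding 1 and [delta] on non-edges confines Henson constraints to cliques; invariance under
    label automorphisms makes the coherent extensions isometries. *)
Definition completable (delta K1 K2 C0 C1 : nat) (V : finType)
    (l : V -> V -> nat) : Prop :=
  exists d : V -> V -> nat,
  [/\ (forall u, d u u = 0) /\ (forall u v, d u v = d v u),
      (forall u v, u != v -> 1 <= d u v <= delta) /\
      (forall u v, 0 < l u v -> d u v = l u v),
      forall u v, u != v -> l u v = 0 -> d u v <> 1 /\ d u v <> delta,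
      forall F : V -> V, injective F -> (forall u v, l (F u) (F v) = l u v) ->
        forall u v, d (F u) (F v) = d u v
    & forall x y z, x != y -> y != z -> x != z ->
        d x z <= d x y + d y z /\
        triangle_allowed K1 K2 C0 C1 (d x y) (d y z) (d x z)].

Lemma EPPA_of_completion delta K1 K2 C0 C1 (S : metricSpace -> Prop) N
    (good : pred (seq nat)) :
  word_class delta N good ->
  (forall a b c, 1 <= a <= delta -> 1 <= b <= delta -> 1 <= c <= delta ->
     a <= b + c -> b <= a + c -> c <= a + b ->
     triangle_allowed K1 K2 C0 C1 a b c -> good [:: a; b; c]) ->
  (forall (V : finType) (l : V -> V -> nat),
     (forall u v, l u v = l v u) -> (forall u, l u u = 0) ->
     (forall u v, l u v <= delta) ->
     (forall t, cycle (adj l) t -> 0 < size t -> good (cyc_labels l t)) ->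
     completable delta K1 K2 C0 C1 l) ->
  (forall X : metricSpace, S X -> henson_constraint delta X) ->
  coherent_EPPA (fun A => class_A delta K1 K2 C0 C1 A /\ class_AS S A).
Proof.
move=> goodP good3 compl SH A [[Ad At] AS].
have [d0 dC dT] := fdist_metric A.
have dle (a b : A) : fdist a b <= delta.
  have [->|/eqP ab] := eqVneq a b; last by case/andP: (Ad a b ab).
  by rewrite (_ : fdist b b = 0) //; apply/d0.
have [|V [l [e [ext [wP clP gl]]]]] := unwinding goodP dle.
  move=> x y z /eqP xy /eqP yz /eqP zx.
  have xz : x <> z by move=> E; apply: zx.
  have := dT x z y; have := dT y x z; have := dT z y x.
  have := At x y z xy yz xz; rewrite /= (dC y x) (dC z y) (dC x z) => tri t1 t2 t3.
  by apply: good3; rewrite ?Ad //; lia.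
have [d [[dr ds] [dd dl] dn dF dt]] :=
  compl V l (wit_sym wP) (wit_irr wP) (wit_le wP) gl.
have dE (a b : A) : d (e a) (e b) = fdist a b.
  have [->|ab] := eqVneq a b; first by rewrite dr; apply/esym/d0.
  by rewrite dl (wit_emb wP) // fdist_gt0.
have dM : is_metric d.
  split=> // [u v|u v w]; first split=> [duv|->//].
    by apply/eqP; apply: contraT => /dd; rewrite duv.
  have [->|uv] := eqVneq u v; first by rewrite dr.
  have [->|vw] := eqVneq v w; first by rewrite dr addn0.
  have [->|uw] := eqVneq u w; first by rewrite dr.
  by case: (dt u v w uv vw uw).
have [extI extE extM] := wit_ext wP.
exists (FinMetricSpace dM); split; first split; first split.
- by move=> u v /eqP; apply: dd.
- by move=> u v w /eqP uv /eqP vw /eqP uw; case: (dt u v w uv vw uw).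
- move=> X SX [i iP]; apply: (AS X SX).
  have edge (x y : X) : i x != i y :> V -> 0 < l (i x) (i y).
    move=> ixy; rewrite lt0n; apply/eqP=> /(dn _ _ ixy)[n1 nd].
    have xy : x <> y by move=> E; rewrite E eqxx in ixy.
    by have := iP x y; case: (SH X SX x y xy) => ->.
  have /clP/clique_mapsP[j jP] : clique l [set v | `[< exists x, i x = v >]].
    by move=> u v; rewrite !inE => /asboolP[x <-] /asboolP[y <-]; apply: edge.
  have iS x : i x \in [set v | `[< exists x, i x = v >]].
    by rewrite inE; apply/asboolP; exists x.
  exists (j \o i) => x y; rewrite -iP /=.
  have [E|ixy] := eqVneq (i x : V) (i y).
    by rewrite E dr; apply/d0.
  by rewrite jP // dl // edge.
exists e; split; first by move=> a b; apply: dE.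
exists ext; split=> [f fP|f g h fP gP hP dfh rfg rgh eh]; last first.
  by apply: extM.
split; last exact: extE.
split; first by apply: injF_bij; apply: extI.
by move=> u v; apply: dF; [apply: extI | apply: wit_aut wP f fP].
Qed.

(** * Case (III) *)

Section CaseThree.

(** [E] is the largest perimeter compatible with both [C0] and [C1] and their parities; [M] is the
    default distance, to which non-edges are set when walks permit. *)
Variables delta K1 K2 C0 C1 E M : nat.
Let C := minn C0 C1.
Let C' := maxn C0 C1.
Hypothesis dK : [/\ 2 < delta, 0 < K1, K1 <= M, 1 < M & M < delta].
Hypothesis dM : [/\ delta <= 2 * M, 2 * delta <= M + 2 * K2,
  2 * delta <= K1 + 2 * K2 + 1, 2 * M + delta <= E & M <= K2].
Hypothesis dE : [/\ 2 * delta + 2 <= E, 2 * delta + K1 <= E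
  & 2 * delta = K1 + 2 * K2 + 1 -> 2 * delta + K1 + 1 <= E].
Hypothesis dC : [/\ C' = E + 2, ~~ odd C0, odd C1
  & C.+1 < C' -> 2 * delta + K2 <= C /\ 2 * delta + M + 1 <= C].

(* Marked letters are the long sides of a cycle. Odd [k] gives the metric
   ([k = 1]) and perimeter inequalities; [k = 0] and [k = 2] are the conditions
   on [K1] and [K2]; [k = 3] is the sharper perimeter bound for one parity. *)
Definition mark_ok3 (k x r : nat) : Prop :=
  [/\ odd k -> E + 2 * x <= 2 * r + k * E,
      k = 0 -> odd r -> 2 * K1 < r,
      k = 2 -> odd (x + r) -> x < 2 * K2 + r
    & k = 3 -> C.+1 < C' -> odd (x + r) = odd C -> x < C + r].

Definition good3 (w : seq nat) : bool :=
  `[< forall k x r, marking w k x r -> mark_ok3 k x r >].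

(** The chord is marked in one half and unmarked in the other, so it cancels when the two
    inequalities are added. For odd [k] it is marked in the half that otherwise has an even number
    of marks. *)
Lemma mark_ok3_split c k1 x1 r1 k2 x2 r2 :
  0 < c <= delta -> x1 <= k1 * delta -> x2 <= k2 * delta ->
  mark_ok3 k1 x1 (c + r1) -> mark_ok3 k1.+1 (c + x1) r1 ->
  mark_ok3 0 0 (c + (x1 + r1)) -> mark_ok3 1 c (x1 + r1) ->
  mark_ok3 k2 x2 (c + r2) -> mark_ok3 k2.+1 (c + x2) r2 ->
  mark_ok3 0 0 (c + (x2 + r2)) -> mark_ok3 1 c (x2 + r2) ->
  mark_ok3 (k1 + k2) (x1 + x2) (r1 + r2).
Proof.
move: dK dM dE dC => [dK1 dK2 dK3 dK4 dK5] [dM1 dM2 dM3 dM4 dM5] [dE1 dE2 dE3].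
move=> [_ _ _ dC4] cP x1P x2P.
move=> [a1 b1 c1 d1] [a2 b2 c2 d2] [_ b3 _ _] [a4 _ _ _].
move=> [a5 b5 c5 d5] [a6 b6 c6 d6] [_ b7 _ _] [a8 _ _ _].
rewrite !mulSn in a2 a6; rewrite mul1n in a4 a8.
have {}a4 := a4 isT; have {}a8 := a8 isT.
split.
- rewrite mulnDl oddD => ok; have [o1|o1] := boolP (odd k1).
    have o2 : ~~ odd k2 by move: ok; rewrite o1.
    by move: (a1 o1) (a6 o2); clear; lia.
  have o2 : odd k2 by move: ok; rewrite (negPf o1).
  by move: (a2 o1) (a5 o2); clear; lia.
- have {}b3 := b3 erefl; have {}b7 := b7 erefl.
  move=> k0; have [k10 k20] : k1 = 0 /\ k2 = 0 by move: k0; clear; lia.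
  move: x1P x2P; rewrite k10 k20 !mul0n !leqn0 => /eqP x10 /eqP x20.
  move: b3 b7 a4 a8; rewrite x10 x20; clear; lia.
- have {}b3 := b3 erefl; have {}b7 := b7 erefl.
  case: k1 k2 => [|[|[|k1]]] [|[|[|k2]]] //
    in x1P x2P a1 b1 c1 d1 a2 b2 c2 d2 a5 b5 c5 d5 a6 b6 c6 d6 *;
    move=> k0 oxr; try by [move: k0; clear; lia].
  (* If the second half with its chord is even, the first is odd, so [c + r1] exceeds [2 * K1]; with
     [c <= r1] this gives [r1 > K1]. Then [x2 <= 2 * delta <= K1 + 2 * K2 + 1], and parity excludes
     equality. *)
  + move: b3 x1P x2P (c5 erefl) oxr a4 dM3; clear; lia.
  + move: (c2 erefl) (c6 erefl) (a1 isT) (a5 isT) oxr; clear; lia.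
  move: b7 x1P x2P (c1 erefl) oxr a8 dM3; clear; lia.
have {}b3 := b3 erefl; have {}b7 := b7 erefl.
case: k1 k2 => [|[|[|[|k1]]]] [|[|[|[|k2]]]] //
    in x1P x2P a1 b1 c1 d1 a2 b2 c2 d2 a5 b5 c5 d5 a6 b6 c6 d6 *;
  move=> k0 CC oxr; try by [move: k0; clear; lia];
  have [C2 C3] := dC4 CC.
- move: b3 x1P x2P (d5 erefl CC) oxr a4 C2 dM3 dK2; clear; lia.
- move: (a1 isT) (c2 erefl) (d6 erefl CC) x1P x2P oxr C2; clear; lia.
- move: (a5 isT) (c6 erefl) (d2 erefl CC) x1P x2P oxr C2; clear; lia.
move: b7 x1P x2P (d1 erefl CC) oxr a8 C2 dM3 dK2; clear; lia.
Qed.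

(** Without a chord, a part with an even number of marks costs nothing in the odd inequality,
    because marked letters are at most [E/2]. *)
Lemma mark_ok3_cat k1 x1 r1 k2 x2 r2 :
  x1 <= k1 * delta -> x2 <= k2 * delta ->
  mark_ok3 k1 x1 r1 -> mark_ok3 0 0 (x1 + r1) ->
  mark_ok3 k2 x2 r2 -> mark_ok3 0 0 (x2 + r2) ->
  mark_ok3 (k1 + k2) (x1 + x2) (r1 + r2).
Proof.
move: dK dM dE dC => [dK1 dK2 dK3 dK4 dK5] [dM1 dM2 dM3 dM4 dM5] [dE1 dE2 dE3].
move=> [_ _ _ dC4] x1P x2P [a1 b1 c1 d1] [_ b3 _ _] [a5 b5 c5 d5] [_ b7 _ _].
have {}b3 := b3 erefl; have {}b7 := b7 erefl.
have half k x : x <= k * delta -> 2 * x <= k * E.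
  move=> xk; apply: (@leq_trans (k * (2 * delta))).
    by rewrite mulnCA leq_mul2l xk orbT.
  by rewrite leq_mul2l; apply/orP; right; move: dE1; clear; lia.
split.
- rewrite mulnDl oddD => ok; have [o1|o1] := boolP (odd k1).
    by move: (a1 o1) (half _ _ x2P); clear; lia.
  have o2 : odd k2 by move: ok; rewrite (negPf o1).
  by move: (a5 o2) (half _ _ x1P); clear; lia.
- move=> k0; have [k10 k20] : k1 = 0 /\ k2 = 0 by move: k0; clear; lia.
  move: x1P x2P; rewrite k10 k20 !mul0n !leqn0 => /eqP x10 /eqP x20.
  move: b3 b7; rewrite x10 x20; clear; lia.
- case: k1 k2 => [|[|[|k1]]] [|[|[|k2]]] //
    in x1P x2P a1 b1 c1 d1 a5 b5 c5 d5 *;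
    move=> k0 oxr; try by [move: k0; clear; lia].
  + move: b3 x1P x2P (c5 erefl) oxr dM3; clear; lia.
  + move: (a1 isT) (a5 isT) x1P x2P oxr dM2 dK5; clear; lia.
  move: b7 x1P x2P (c1 erefl) oxr dM3; clear; lia.
case: k1 k2 => [|[|[|[|k1]]]] [|[|[|[|k2]]]] //
    in x1P x2P a1 b1 c1 d1 a5 b5 c5 d5 *;
  move=> k0 CC oxr; try by [move: k0; clear; lia];
  have [C2 C3] := dC4 CC.
- move: b3 x1P x2P (d5 erefl CC) oxr C2 dM3 dK2; clear; lia.
- move: (a1 isT) x1P x2P C3; clear; lia.
- move: (a5 isT) x1P x2P C3; clear; lia.
move: b7 x1P x2P (d1 erefl CC) oxr C2 dM3 dK2; clear; lia.
Qed.

Lemma marking_nil k x r : marking [::] k x r -> [/\ k = 0, x = 0 & r = 0].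
Proof. by move E0: [::] => w mw; case: mw E0. Qed.

(** For long words the odd inequality follows from [marking_cost]. For [k] at most 3 the unmarked
    sum is at least the length minus 3, while the marked sum is at most [3 * delta]. *)
Lemma word_class3 : word_class delta (E + 2 * K1 + 3 * delta + 4) good3.
Proof.
have good3P w k x r : good3 w -> marking w k x r -> mark_ok3 k x r.
  by move/asboolP; apply.
split.
- move=> w1 w2 g; apply/asboolP=> k x r.
  case/marking_split=> k1 [x1 [r1 [k2 [x2 [r2 [m1 m2 -> -> ->]]]]]].
  by apply: good3P g _; rewrite (addnC k1) (addnC x1) (addnC r1); apply: marking_cat.
- move=> c w1 w2 cP l1 l2 g1 g2; apply/asboolP=> k x r.
  case/marking_split=> k1 [x1 [r1 [k2 [x2 [r2 [m1 m2 -> -> ->]]]]]].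
  apply: (mark_ok3_split cP (marking_le l1 m1) (marking_le l2 m2)).
  + by apply: good3P g1 _; apply: MarkOff.
  + by apply: good3P g1 _; apply: MarkOn.
  + by apply: good3P g1 _; rewrite (marking_sum m1); apply/MarkOff/marking_off.
  + apply: good3P g1 _; rewrite (marking_sum m1) -{2}[c]addn0.
    exact/MarkOn/marking_off.
  + by apply: good3P g2 _; apply: MarkOff.
  + by apply: good3P g2 _; apply: MarkOn.
  + by apply: good3P g2 _; rewrite (marking_sum m2); apply/MarkOff/marking_off.
  apply: good3P g2 _; rewrite (marking_sum m2) -{2}[c]addn0.
  exact/MarkOn/marking_off.
- move=> w1 w2 l1 l2 g1 g2; apply/asboolP=> k x r.
  case/marking_split=> k1 [x1 [r1 [k2 [x2 [r2 [m1 m2 -> -> ->]]]]]].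
  apply: (mark_ok3_cat (marking_le l1 m1) (marking_le l2 m2)).
  + exact: good3P g1 m1.
  + by apply: good3P g1 _; rewrite (marking_sum m1); apply: marking_off.
  + exact: good3P g2 m2.
  by apply: good3P g2 _; rewrite (marking_sum m2); apply: marking_off.
- move=> w lw sw; apply/asboolP=> k x r mw; have [dE1 _ _] := dE.
  move: (marking_cost dE1 lw mw) (marking_size lw mw) (marking_le lw mw) sw.
  clear; move=> c1 c2 c3 sw; split.
  + by move: c1 sw; clear; lia.
  + by move=> k0; move: c2 sw; rewrite k0; clear; lia.
  + by move=> k0; move: c2 c3 sw; rewrite k0; clear; lia.
  by move=> k0; move: c2 c3 sw; rewrite k0; clear; lia.
move=> a; apply/asboolP=> k x r mw.
by case/marking_cons: mw => [[r1 -> mw]|[k1 [x1 [-> -> mw]]]];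
  case/marking_cons: mw => [[r2 -> mw]|[k2 [x2 [-> -> mw]]]];
  case/marking_nil: mw => -> -> ->; split=> //; rewrite ?mul0n; clear; lia.
Qed.

Lemma good3_triangle a b c :
  a <= b + c -> b <= a + c -> c <= a + b ->
  triangle_allowed K1 K2 C0 C1 a b c -> good3 [:: a; b; c].
Proof.
move=> t1 t2 t3; rewrite /triangle_allowed => -[todd teven].
have [dC1 o0 o1 _] := dC.
have pE : a + b + c <= E.
  move: dC1; rewrite /C'; case: (boolP (odd (a + b + c))) => [op|ep].
    by have [_ _ pC1] := todd op; move: o0 o1 op pC1; clear; lia.
  by move: ep o0 o1 (teven ep); clear; lia.
have pC : odd (a + b + c) = odd C -> a + b + c < C.
  rewrite /C; case: (boolP (odd (a + b + c))) => [op|ep].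
    by have [_ _ pC1] := todd op; move: o0 o1 op pC1; clear; lia.
  by move: ep o0 o1 (teven ep); clear; lia.
have pK1 : odd (a + b + c) -> 2 * K1 < a + b + c by case/todd.
have pK2 : odd (a + b + c) -> a + b + c < 2 * K2 + 2 * minn a (minn b c).
  by case/todd.
clear -t1 t2 t3 pE pC pK1 pK2.
apply/asboolP=> k x r mw.
by case/marking_cons: mw => [[r1 -> mw]|[k1 [x1 [-> -> mw]]]];
  case/marking_cons: mw => [[r2 -> mw]|[k2 [x2 [-> -> mw]]]];
  case/marking_cons: mw => [[r3 -> mw]|[k3 [x3 [-> -> mw]]]];
  case/marking_nil: mw => -> -> ->; split=> //; rewrite ?mulSn ?mul0n => _;
  [lia..].
Qed.

(** * Triangles of the completion in Case (III) *)

Section Completion3.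

Variables (V : finType) (l : V -> V -> nat).
Hypothesis lC : forall u v, l u v = l v u.
Hypothesis l_le : forall u v, l u v <= delta.
Hypothesis closed : forall u n k x r, mwalk l u u n k x r -> mark_ok3 k x r.
Implicit Types u v : V.

(* Walking along a marked edge replaces its length [a] by [E/2 - a] and passes
   to the antipode in a formal double cover where antipodes are at distance
   [E/2]; [up3] and [lo3] are the distance bounds given by shortest paths. *)
Definition up3 u v t : Prop := exists n h x r,
  mwalk l u v n (h + h) x r /\ t + x = r + h * E.
Definition lo3 u v t : Prop := exists n h x r,
  mwalk l u v n (h + h).+1 x r /\ t + r + h * E = x.

Lemma up3_sym u v t : up3 u v t -> up3 v u t.
Proof. by case=> n [h [x [r [/(mwalk_rev lC) w e]]]]; exists n, h, x, r. Qed.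

Lemma lo3_sym u v t : lo3 u v t -> lo3 v u t.
Proof. by case=> n [h [x [r [/(mwalk_rev lC) w e]]]]; exists n, h, x, r. Qed.

Lemma up3_up u v w s t : up3 u v s -> up3 v w t -> up3 u w (s + t).
Proof.
case=> n1 [h1 [x1 [r1 [w1 e1]]]] [n2 [h2 [x2 [r2 [w2 e2]]]]].
exists (n1 + n2), (h1 + h2), (x1 + x2), (r1 + r2); split.
  by rewrite addnACA; apply: mwalk_cat w1 w2.
by rewrite mulnDl; move: e1 e2; clear; lia.
Qed.

Lemma lo3_up u v w s t : lo3 u v s -> up3 v w t -> t <= s -> lo3 u w (s - t).
Proof.
case=> n1 [h1 [x1 [r1 [w1 e1]]]] [n2 [h2 [x2 [r2 [w2 e2]]]]] ts.
exists (n1 + n2), (h1 + h2), (x1 + x2), (r1 + r2); split.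
  by rewrite addnACA -addSn; apply: mwalk_cat w1 w2.
by rewrite mulnDl; move: e1 e2 ts; clear; lia.
Qed.

Lemma lo3_lo u v w s t : lo3 u v s -> lo3 v w t -> s + t <= E ->
  up3 u w (E - s - t).
Proof.
case=> n1 [h1 [x1 [r1 [w1 e1]]]] [n2 [h2 [x2 [r2 [w2 e2]]]]] st.
exists (n1 + n2), (h1 + h2).+1, (x1 + x2), (r1 + r2); split; last first.
  by rewrite mulSn mulnDl; move: e1 e2 st; clear; lia.
have -> : (h1 + h2).+1 + (h1 + h2).+1 = (h1 + h1).+1 + (h2 + h2).+1.
  by clear; lia.
exact: mwalk_cat w1 w2.
Qed.

(** The two walks together are a closed walk with an odd number of marks. *)
Lemma lo3_le_up u v s t : lo3 u v s -> up3 u v t -> s <= t.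
Proof.
case=> n1 [h1 [x1 [r1 [w1 e1]]]] /up3_sym[n2 [h2 [x2 [r2 [w2 e2]]]]].
have [H _ _ _] := closed (mwalk_cat w1 w2).
have /H : odd ((h1 + h1).+1 + (h2 + h2)) by clear; lia.
by rewrite mulnDl mulSn !mulnDl; move: e1 e2; clear; lia.
Qed.

Lemma double_le h x : x <= (h + h) * delta -> x <= h * E.
Proof.
move=> xh; apply: leq_trans xh _; rewrite mulnDl -mulnDr leq_mul2l.
by apply/orP; right; have [d1 _ _] := dE; move: d1; clear; lia.
Qed.

(** Every pair of marks gains at most [2 * delta - E], which is negative. So a bound that uses marks
    is no better than that of a single pair, [E - 2 * delta]. *)
Lemma up3_plain u v t : up3 u v t ->
  (exists n, mwalk l u v n 0 0 t) \/ E <= t + 2 * delta.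
Proof.
case=> n [[|h] [x [r [w e]]]]; have xP := mwalk_le l_le w.
  left; exists n; have x0 : x = 0 by move: xP; clear; lia.
  have -> : t = r by move: e x0; clear; lia.
  by rewrite x0 in w.
right; have /double_le : x - 2 * delta <= (h + h) * delta.
  by move: xP; rewrite addSn addnS !mulSn; clear; lia.
by move: e; rewrite mulSn; clear; lia.
Qed.

Lemma lo3_plain u v t : lo3 u v t ->
  (exists n x r, mwalk l u v n 1 x r /\ t + r = x) \/ t + E <= 3 * delta.
Proof.
case=> n [[|h] [x [r [w e]]]]; have xP := mwalk_le l_le w.
  by left; exists n, x, r; split=> //; move: e; clear; lia.
right; have /double_le : x - 3 * delta <= (h + h) * delta.
  by move: xP; rewrite addSn addnS !mulSn; clear; lia.
by move: e; rewrite mulSn; clear; lia.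
Qed.

Lemma lo3_delta u v t : lo3 u v t -> t <= delta.
Proof.
have [d1 _ _] := dE; case/lo3_plain=> [[n [x [r [w e]]]]|]; last first.
  by move: d1; clear; lia.
by move: (mwalk_le l_le w) e; clear; lia.
Qed.

Lemma up3_gt0 u v t : u != v -> up3 u v t -> 0 < t.
Proof.
have [d1 _ _] := dE => uv [n [h [x [r [w e]]]]].
have n0 := mwalk_gt0 uv w.
by move: (mwalk_cost l_le d1 w) n0 e; rewrite mulnDl; clear; lia.
Qed.

Lemma up3_nonedge u v t : u != v -> l u v = 0 -> up3 u v t -> 1 < t.
Proof.
have [d1 _ _] := dE => uv luv [n [h [x [r [w e]]]]].
have n0 := mwalk_gt1 uv luv w.
by move: (mwalk_cost l_le d1 w) n0 e; rewrite mulnDl; clear; lia.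
Qed.

(** A walk between non-adjacent vertices has at least two edges; with one mark, an unmarked edge is
    subtracted from a marked one of length at most [delta]. *)
Lemma lo3_nonedge u v t : u != v -> l u v = 0 -> lo3 u v t -> t < delta.
Proof.
have [d1 _ _] := dE => uv luv.
case/lo3_plain=> [[n [x [r [w e]]]]|]; last by move: d1; clear; lia.
move: (mwalk_gt1 uv luv w) (mwalk_le l_le w) (mwalk_size l_le w) e.
by clear; lia.
Qed.

Lemma up3_edge u v : 0 < l u v -> up3 u v (l u v).
Proof.
move=> uv; exists 1, 0, 0, (l u v).
by rewrite !addn0; split=> //; apply: mwalk_off.
Qed.

Lemma lo3_edge u v : 0 < l u v -> lo3 u v (l u v).
Proof.
move=> uv; exists 1, 0, (l u v), 0.
by rewrite !addn0; split=> //; apply: mwalk_on.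
Qed.

Variable d : V -> V -> nat.
Hypothesis dP : forall u v, u != v -> clamped (up3 u v) (lo3 u v) M (d u v).

Lemma d3_le u v : u != v -> d u v <= delta.
Proof.
move=> uv; have [_ _ _ L] := dP uv; have [_ _ _ _ d5] := dK.
have [dM'|Md] := leqP (d u v) M; first by move: d5 dM'; clear; lia.
exact: lo3_delta (L Md).
Qed.

Section Triangle.

Variables x y z : V.
Hypotheses (xy : x != y) (yz : y != z) (xz : x != z).

(** A side below [M] is attained by an upper walk and one above [M] by a lower walk. Two short sides
    compose to an upper bound of the third; a long third side and one short side compose to a lower
    bound of the other. If neither side is below [M], then [2 * M >= delta] suffices. *)
Lemma d3_triangle : d x z <= d x y + d y z.
Proof.
have [d1 d2 d3 d4 d6] := dM.
have [U1 L1 u1 l1] := dP xy; have [U2 L2 u2 l2] := dP yz.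
have [U3 L3 u3 l3] := dP xz; have c_le := d3_le xz.
have [aM|aM] := ltnP (d x y) M; have [bM|bM] := ltnP (d y z) M.
- by apply: U3; apply: up3_up (u1 aM) (u2 bM).
- rewrite leqNgt; apply/negP=> lt.
  have /l3 L : M < d x z by move: bM lt; clear; lia.
  have /L2 : lo3 y z (d x z - d x y).
    apply: lo3_sym; apply: lo3_up (lo3_sym L) (u1 aM) _.
    by move: lt; clear; lia.
  by move: lt; clear; lia.
- rewrite leqNgt; apply/negP=> lt.
  have /l3 L : M < d x z by move: aM lt; clear; lia.
  have /L1 : lo3 x y (d x z - d y z).
    by apply: lo3_up L (up3_sym (u2 bM)) _; move: lt; clear; lia.
  by move: lt; clear; lia.
by move: aM bM c_le d1; clear; lia.
Qed.

(** Two sides above [M] compose to an upper bound of the third. If at most one side exceeds [M], the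
    perimeter is at most [2 * M + delta]. *)
Lemma d3_perimeter : d x y + d y z + d x z <= E.
Proof.
have [d1 d2 d3 d4 d6] := dM; have [e1 _ _] := dE.
have [U1 L1 u1 l1] := dP xy; have [U2 L2 u2 l2] := dP yz.
have [U3 L3 u3 l3] := dP xz.
have := d3_le xy; have := d3_le yz; have := d3_le xz => c_le b_le a_le.
have [aM|aM] := leqP (d x y) M; have [bM|bM] := leqP (d y z) M.
- by move: aM bM c_le d4; clear; lia.
- have [cM|cM] := leqP (d x z) M; first by move: aM cM b_le d4; clear; lia.
  have /U1 : up3 x y (E - d x z - d y z).
    apply: lo3_lo (l3 cM) (lo3_sym (l2 bM)) _.
    by move: b_le c_le e1; clear; lia.
  by move: b_le c_le e1; clear; lia.
- have [cM|cM] := leqP (d x z) M; first by move: bM cM a_le d4; clear; lia.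
  have /U2 : up3 y z (E - d x y - d x z).
    apply: lo3_lo (lo3_sym (l1 aM)) (l3 cM) _.
    by move: a_le c_le e1; clear; lia.
  by move: a_le c_le e1; clear; lia.
have /U3 : up3 x z (E - d x y - d y z).
  by apply: lo3_lo (l1 aM) (l2 bM) _; move: a_le b_le e1; clear; lia.
by move: a_le b_le e1; clear; lia.
Qed.

Lemma d3_plain u v : u != v -> d u v < K1 -> exists n, mwalk l u v n 0 0 (d u v).
Proof.
move=> uv lt; have [_ _ d3 _ _] := dK; have [_ e2 _] := dE.
have [_ _ U _] := dP uv.
case: (up3_plain (U (leq_trans lt d3))) => //.
by move: lt e2; clear; lia.
Qed.

Lemma d3_K1 : d x y < K1 -> d y z < K1 -> d x z < K1 ->
  odd (d x y + d y z + d x z) -> 2 * K1 < d x y + d y z + d x z.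
Proof.
move=> aK bK cK op; have [n1 w1] := d3_plain xy aK.
have [n2 w2] := d3_plain yz bK; have [n3 /(mwalk_rev lC) w3] := d3_plain xz cK.
have [_ H _ _] := closed (mwalk_cat (mwalk_cat w1 w2) w3).
exact: H.
Qed.

(** A violation forces [x z] below [M] and the other two sides above [M], so all three are attained
    by walks. Once walks with more marks are excluded, they form a closed walk with two marks. *)
Lemma d3_K2 : d y z <= d x y + d x z -> d x y <= d y z + d x z ->
  odd (d x y + d y z + d x z) -> d x y + d y z < 2 * K2 + d x z.
Proof.
move=> tb ta op; rewrite ltnNge; apply/negP=> lt.
have [d1 d2 d3 d4 d6] := dM; have [k1 k2 k3 k4 k5] := dK; have [e1 e2 e3] := dE.
have [_ _ _ l1] := dP xy; have [_ _ _ l2] := dP yz; have [_ _ u3 _] := dP xz.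
have := d3_le xy; have := d3_le yz => b_le a_le.
have cM : d x z < M by move: a_le b_le d2 lt op; clear; lia.
have aM : M < d x y by move: d6 lt tb op; clear; lia.
have bM : M < d y z by move: d6 lt ta op; clear; lia.
have c0 := up3_gt0 xz (u3 cM).
case: (lo3_plain (l1 aM)) => [[n1 [x1 [r1 [w1 e1']]]]|big]; last first.
  by move: big lt op c0 b_le d3 e2; clear; lia.
case: (lo3_plain (l2 bM)) => [[n2 [x2 [r2 [w2 e2']]]]|big]; last first.
  by move: big lt op c0 a_le d3 e2; clear; lia.
case: (up3_plain (u3 cM)) => [[n3 /(mwalk_rev lC) w3]|big]; last first.
  (* The boundary case, excluded by the third condition on [E]. *)
  have cK : d x z = K1 by move: big lt op a_le b_le d3 e2; clear; lia.
  have /e3 : 2 * delta = K1 + 2 * K2 + 1.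
    by move: lt op a_le b_le d3; rewrite cK; clear; lia.
  by move: big; rewrite cK; clear; lia.
have [_ _ H _] := closed (mwalk_cat (mwalk_cat w1 w2) w3).
have /H : 1 + 1 + 0 = 2 by [].
by move: e1' e2' lt op; clear; lia.
Qed.

(** Since [C] is at least [2 * delta + M + 1], a violation puts all three sides above [M], and their
    lower walks form a closed walk with three marks. *)
Lemma d3_C : C.+1 < C' -> odd (d x y + d y z + d x z) = odd C ->
  d x y + d y z + d x z < C.
Proof.
move=> CC op; rewrite ltnNge; apply/negP=> lt.
have [d1 _ _ _ _] := dM; have [dC1 _ _ /(_ CC)[_ c2]] := dC.
have [_ _ _ l1] := dP xy; have [_ _ _ l2] := dP yz; have [_ _ _ l3] := dP xz.
have := d3_le xy; have := d3_le yz; have := d3_le xz => c_le b_le a_le.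
have aM : M < d x y by move: lt b_le c_le c2; clear; lia.
have bM : M < d y z by move: lt a_le c_le c2; clear; lia.
have cM : M < d x z by move: lt a_le b_le c2; clear; lia.
have CE : C <= E by move: dC1 CC; clear; lia.
case: (lo3_plain (l1 aM)) => [[n1 [x1 [r1 [w1 e1]]]]|big]; last first.
  by move: big aM CE c2 d1; clear; lia.
case: (lo3_plain (l2 bM)) => [[n2 [x2 [r2 [w2 e2]]]]|big]; last first.
  by move: big bM CE c2 d1; clear; lia.
case: (lo3_plain (l3 cM)) => [[n3 [x3 [r3 [/(mwalk_rev lC) w3 e3]]]]|big]; last first.
  by move: big cM CE c2 d1; clear; lia.
have [_ _ _ H] := closed (mwalk_cat (mwalk_cat w1 w2) w3).
have op' : odd (x1 + x2 + x3 + (r1 + r2 + r3)) = odd C.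
  by rewrite -op; move: e1 e2 e3; clear; lia.
have := H erefl CC op'.
by move: e1 e2 e3 lt; clear; lia.
Qed.

End Triangle.

Lemma d3_sym u v : u != v -> d u v = d v u.
Proof.
move=> uv; have vu : v != u by rewrite eq_sym.
apply: clamped_unique (dP uv) _.
by apply: clamped_eq (dP vu) => s; split; by [exact: up3_sym | exact: lo3_sym].
Qed.

Lemma d3_allowed x y z : x != y -> y != z -> x != z ->
  triangle_allowed K1 K2 C0 C1 (d x y) (d y z) (d x z).
Proof.
move=> xy yz xz; have [yx zy zx] : [/\ y != x, z != y & z != x].
  by split; rewrite eq_sym.
have t1 := d3_triangle xy yz xz; have t2 := d3_triangle yx xz yz.
have t3 := d3_triangle xz zy xy.
have pE := d3_perimeter xy yz xz.
have pK1 := d3_K1 xy yz xz.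
have pa := d3_K2 xy yz xz; have pb := d3_K2 yx xz yz; have pc := d3_K2 xz zy xy.
have pC := d3_C xy yz xz.
rewrite (d3_sym yx) ?(d3_sym zy) in t2 t3 pb pc.
have [dC1 o0 o1 _] := dC; rewrite /triangle_allowed.
move: (d x y) (d y z) (d x z) t1 t2 t3 pE pK1 pa pb pc pC => a b c.
move=> t1 t2 t3 pE pK1 pa pb pc pC.
have p1 : odd (a + b + c) -> 2 * K1 < a + b + c.
  move=> op; rewrite ltnNge; apply/negP=> le.
  (* By the triangle inequality twice each side is at most the perimeter, which is odd and at most
     [2 * K1]. *)
  have [aK bK cK] : [/\ a < K1, b < K1 & c < K1].
    by move: op le t1 t2 t3; clear; split; lia.
  by move: (pK1 aK bK cK op) le; clear; lia.
have p2 : odd (a + b + c) -> a + b + c < 2 * K2 + 2 * minn a (minn b c).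
  move=> op.
  have qa : a + b < 2 * K2 + c by apply: pa => //; move: t2 t3; clear; lia.
  have qb : a + c < 2 * K2 + b.
    by apply: pb; [move: t1; clear; lia | move: t3; clear; lia | move: op; clear; lia].
  have qc : c + b < 2 * K2 + a.
    by apply: pc; [move: t2; clear; lia | move: t1; clear; lia | move: op; clear; lia].
  by move: qa qb qc; clear; lia.
have p3 : odd (a + b + c) = odd C -> a + b + c < C.
  (* If [C'] is at most [C + 1], then [E = C' - 2] is below [C] and the general perimeter bound
     suffices. *)
  have [CC|CC] := ltnP C.+1 C'; first exact: pC.
  by move: CC dC1 pE o0 o1; rewrite /C /C'; clear; lia.
split=> op; first split; [exact: p1 | exact: p2 | |].
  by move: op dC1 pE p3 o0 o1; rewrite /C /C'; clear; lia.
by move: op dC1 pE p3 o0 o1; rewrite /C /C'; clear; lia.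
Qed.

End Completion3.

Lemma completable3 (V : finType) (l : V -> V -> nat) :
  (forall u v, l u v = l v u) -> (forall u, l u u = 0) ->
  (forall u v, l u v <= delta) ->
  (forall t, cycle (adj l) t -> 0 < size t -> good3 (cyc_labels l t)) ->
  completable delta K1 K2 C0 C1 l.
Proof.
move=> lC l0 l_le gl; have [k1 k2 k3 k4 k5] := dK.
have cl : forall u n k x r, mwalk l u u n k x r -> mark_ok3 k x r.
  by apply: (mwalk_closed l_le gl) => [w k x r _ /asboolP|]; [apply | split].
have /choice[d0 d0P] : forall p : V * V, exists t,
    if p.1 == p.2 then t = 0 else clamped (up3 l p.1 p.2) (lo3 l p.1 p.2) M t.
  case=> u v /=; case: eqP => _; first by exists 0.
  apply: (@clamped_exists _ _ _ delta) => [s t|s]; first exact: lo3_le_up.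
  exact: lo3_delta.
pose d u v := d0 (u, v).
have dr u : d u u = 0 by have := d0P (u, u); rewrite /= eqxx.
have dP u v : u != v -> clamped (up3 l u v) (lo3 l u v) M (d u v).
  by move=> uv; have := d0P (u, v); rewrite /= (negPf uv).
exists d; split.
- split=> // u v; have [->|uv] := eqVneq u v; first by [].
  exact: (d3_sym lC dP).
- split=> u v uv.
    have [_ _ U _] := dP _ _ uv; rewrite (d3_le l_le dP) // andbT.
    have [dM'|/U] := leqP M (d u v); first by move: k4 dM'; clear; lia.
    exact: up3_gt0.
  have nuv : u != v by apply: contraL uv => /eqP->; rewrite l0.
  have [U L _ _] := dP _ _ nuv; apply/eqP; rewrite eqn_leq.
  by rewrite U ?L //; [apply: lo3_edge | apply: up3_edge].
- move=> u v uv luv; have [_ _ U L] := dP _ _ uv.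
  case: (ltngtP (d u v) M) => [dM'|dM'|->]; last by move: k4 k5; clear; lia.
  + have := up3_nonedge l_le uv luv (U dM').
    by move: dM' k5; clear; lia.
  have := lo3_nonedge l_le uv luv (L dM').
  by move: dM' k4; clear; lia.
- move=> F FI lF u v; have [->|uv] := eqVneq u v; first by rewrite !dr.
  have Fuv : F u != F v by rewrite (inj_eq FI).
  apply: clamped_unique (dP _ _ Fuv) _; apply: clamped_eq (dP _ _ uv) => s.
    by split=> -[n [h [x [r [w e]]]]]; exists n, h, x, r; split=> //;
      apply/(mwalk_aut FI lF).
  by split=> -[n [h [x [r [w e]]]]]; exists n, h, x, r; split=> //;
    apply/(mwalk_aut FI lF).
move=> x y z xy yz xz; split; first exact: (d3_triangle lC l_le dP).
exact: (d3_allowed lC l_le cl dP).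
Qed.

End CaseThree.

(** * The exceptional parameters of Case (II) *)

Section CaseTwo.

Variables delta K : nat.
Hypothesis dP : [/\ 7 < delta, 3 * K + 1 = 2 * delta & odd K].

(* A triangle of odd perimeter is allowed iff its [mu]-perimeter exceeds [2K];
   one of even perimeter is allowed iff it is metric, and then its sides also
   satisfy the triangle inequality for [mu]. *)
Definition mu (a : nat) : nat := minn a (2 * K - a).

Definition polygon (f : nat -> nat) (w : seq nat) : bool :=
  all (fun a => 2 * f a <= sumn (map f w)) w.

Definition good2 (w : seq nat) : bool :=
  [&& polygon id w, polygon mu w & odd (sumn w) ==> (2 * K < sumn (map mu w))].

Lemma polygonP f w :
  reflect (forall a, a \in w -> 2 * f a <= sumn (map f w)) (polygon f w).
Proof. exact: allP. Qed.

Lemma polygon_rot f w1 w2 : polygon f (w1 ++ w2) -> polygon f (w2 ++ w1).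
Proof.
move=> /polygonP p; apply/polygonP => a aw.
rewrite map_cat sumn_cat addnC -sumn_cat -map_cat; apply: p.
by move: aw; rewrite !mem_cat orbC.
Qed.

(** The chord is at most the sum of either side, so each side can replace it in the inequality of
    the other. *)
Lemma polygon_split f c w1 w2 :
  polygon f (c :: w1) -> polygon f (c :: w2) -> polygon f (w1 ++ w2).
Proof.
move=> /polygonP p1 /polygonP p2.
have := p1 c (mem_head _ _); have := p2 c (mem_head _ _) => /= c2 c1.
apply/polygonP=> a; rewrite mem_cat map_cat sumn_cat => /orP[aw|aw].
  have /= := p1 a; rewrite inE aw orbT => /(_ isT).
  by move: c2; clear; lia.
have /= := p2 a; rewrite inE aw orbT => /(_ isT).
by move: c1; clear; lia.
Qed.

Lemma polygon_cat f w1 w2 :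
  polygon f w1 -> polygon f w2 -> polygon f (w1 ++ w2).
Proof.
move=> /polygonP p1 /polygonP p2; apply/polygonP=> a.
rewrite mem_cat map_cat sumn_cat => /orP[/p1|/p2]; clear; lia.
Qed.

Lemma mu_gt0 a : 0 < a <= delta -> 0 < mu a <= delta.
Proof. by have [d1 d2 _] := dP; rewrite /mu; move: d1 d2; clear; lia. Qed.

Lemma size_le_sumn (f : nat -> nat) w :
  all (fun a => 0 < f a) w -> size w <= sumn (map f w).
Proof. by elim: w => //= a w IH /andP[a0 /IH]; move: a0; clear; lia. Qed.

Lemma word_class2 : word_class delta (2 * delta + 2 * K) good2.
Proof.
split.
- move=> w1 w2 /and3P[p1 p2 p3]; rewrite /good2 (polygon_rot p1) (polygon_rot p2) /=.
  by move: p3; rewrite !sumn_cat !map_cat !sumn_cat addnC [X in _ < X]addnC.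
- move=> c w1 w2 cP l1 l2 /and3P[p1 p2 /implyP p3] /and3P[q1 q2 /implyP q3].
  rewrite /good2 (polygon_split p1 q1) (polygon_split p2 q2) /=.
  apply/implyP; rewrite !map_cat !sumn_cat oddD.
  have /= := polygonP _ _ p2 c (mem_head _ _).
  have /= := polygonP _ _ q2 c (mem_head _ _) => c2 c1.
  move: p3 q3 => /=; rewrite !oddD => p3 q3 odd12.
  (* The chord is counted in both halves, so exactly one half is odd. Its [mu]-perimeter exceeds
     [2 * K], and [mu c] is at most the [mu]-length of the rest of the other half. *)
  case oc: (odd c (+) odd (sumn w1)).
    by move: (p3 oc) c2; clear; lia.
  have /q3 : odd c (+) odd (sumn w2).
    by move: oc odd12; do 3!case: (odd _).
  by move: c1; clear; lia.
- move=> w1 w2 l1 l2 /and3P[p1 p2 /implyP p3] /and3P[q1 q2 /implyP q3].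
  rewrite /good2 (polygon_cat p1 q1) (polygon_cat p2 q2) /=; apply/implyP.
  rewrite !map_cat !sumn_cat oddD; case o1: (odd (sumn w1)) => o2.
    by move: (p3 o1); clear; lia.
  by move: (q3 o2); clear; lia.
- move=> w lw sw; have [d1 d2 _] := dP.
  have s1 : size w <= sumn (map id w).
    by apply: size_le_sumn; apply: sub_all lw => a /andP[].
  have s2 : size w <= sumn (map mu w).
    by apply: size_le_sumn; apply: sub_all lw => a /mu_gt0/andP[].
  apply/and3P; split.
  + apply/polygonP=> a /(allP lw) /=; move: s1 sw; clear; lia.
  + apply/polygonP=> a /(allP lw)/mu_gt0; move: s2 sw; clear.
    by move: (mu a) (sumn _) (size w) => x y z; lia.
  by apply/implyP=> _; move: s2 sw; clear; lia.
move=> a; rewrite /good2 /polygon /=; clear.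
by apply/and3P; split; lia.
Qed.

(** For odd perimeter the triangle inequality for [mu] is automatic: no value exceeds [K] and the
    three add up to more than [2 * K]. *)
Lemma good2_triangle a b c :
  1 <= a <= delta -> 1 <= b <= delta -> 1 <= c <= delta ->
  a <= b + c -> b <= a + c -> c <= a + b ->
  triangle_allowed K K (3 * delta + 2) (4 * K + 1) a b c -> good2 [:: a; b; c].
Proof.
have [d1 d2 oK] := dP; rewrite /triangle_allowed => aP bP cP t1 t2 t3 [todd _].
have to : odd (a + b + c) -> 2 * K < mu a + mu b + mu c.
  move=> op; case: (todd op); rewrite /mu.
  by move: op d1 d2 aP bP cP t1 t2 t3; clear; lia.
have te : ~~ odd (a + b + c) ->
    [/\ mu a <= mu b + mu c, mu b <= mu a + mu c & mu c <= mu a + mu b].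
  by rewrite /mu; move: d1 d2 oK aP bP cP t1 t2 t3; clear; split; lia.
have mK e : mu e <= K by rewrite /mu; clear; lia.
have [m1 m2 m3] : [/\ mu a <= mu b + mu c, mu b <= mu a + mu c
    & mu c <= mu a + mu b].
  case: (boolP (odd (a + b + c))) => [/to|/te //].
  by move: (mK a) (mK b) (mK c); clear; split; lia.
rewrite /good2 /polygon /= !addn0 !addnA.
apply/and3P; split; last exact/implyP.
  by move: t1 t2 t3; clear; lia.
by move: m1 m2 m3; clear; lia.
Qed.

Definition mark_ok2 (k x r : nat) : Prop :=
  (k = 1 -> x <= r) /\ (odd (x + r) -> 2 * K + x < r + 2 * K * k).

(** A mark chooses the term [2 * K - a] in the minimum [mu a], its absence the term [a]; so
    [r + 2 * K * k - x] bounds the [mu]-length. *)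
Lemma marking_mu w k x r : labels_in delta w -> marking w k x r ->
  sumn (map mu w) + x <= r + 2 * K * k.
Proof.
have [d1 d2 _] := dP; move=> + mw.
elim: mw => //= a w' k' x' r' _ IH /andP[aP /IH]; rewrite /mu ?mulnS.
  by clear; lia.
by move: d1 d2 aP; clear; lia.
Qed.

Lemma marking0 w x r : marking w 0 x r -> x = 0.
Proof.
move E: 0 => k mw; elim: mw E => // a w' k' x' r' _ IH E; exact: IH.
Qed.

Lemma marking1_mem w x r : marking w 1 x r -> x \in w.
Proof.
move E: 1 => k mw; elim: mw E => // a w' k' x' r' mw IH.
  by move/IH => xw; rewrite inE xw orbT.
by case=> k0; rewrite -k0 in mw; rewrite (marking0 mw) addn0 mem_head.
Qed.

Lemma good2_mark w k x r : labels_in delta w -> good2 w -> marking w k x r ->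
  mark_ok2 k x r.
Proof.
move=> lw /and3P[/polygonP p1 _ /implyP p3] mw; have sw := marking_sum mw.
split=> [k1|oxr].
  rewrite k1 in mw; have := p1 _ (marking1_mem mw); rewrite map_id -sw.
  by clear; lia.
have := p3; rewrite -sw => /(_ oxr).
by move: (marking_mu lw mw); clear; lia.
Qed.

(** * Triangles of the completion for the exceptional parameters *)

Section Completion2.

Variables (V : finType) (l : V -> V -> nat).
Hypothesis lC : forall u v, l u v = l v u.
Hypothesis l_le : forall u v, l u v <= delta.
Hypothesis closed : forall u n k x r, mwalk l u u n k x r -> mark_ok2 k x r.
Implicit Types u v : V.

Definition up2 u v t : Prop := exists n, mwalk l u v n 0 0 t.
Definition lo2 u v t : Prop := exists n x r, mwalk l u v n 1 x r /\ t + r = x.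

(* A walk whose [mu]-length is at most [K]; all of them have the same parity,
   which forces the parity of the distance. *)
Definition short u v (b : bool) : Prop := exists n k x r,
  [/\ mwalk l u v n k x r, odd (x + r) = b & r + 2 * K * k <= K + x].

(** As [K] is odd, the chosen value has the parity of the short walks, if there are any. *)
Definition centre u v : nat := if `[< short u v false >] then K.-1 else K.

Lemma up2_sym u v t : up2 u v t -> up2 v u t.
Proof. by case=> n /(mwalk_rev lC) w; exists n. Qed.

Lemma lo2_sym u v t : lo2 u v t -> lo2 v u t.
Proof. by case=> n [x [r [/(mwalk_rev lC) w e]]]; exists n, x, r. Qed.

Lemma short_sym u v b : short u v b -> short v u b.
Proof. by case=> n [k [x [r [/(mwalk_rev lC) w e1 e2]]]]; exists n, k, x, r. Qed.

Lemma up2_up u v w s t : up2 u v s -> up2 v w t -> up2 u w (s + t).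
Proof. by case=> n1 w1 [n2 w2]; exists (n1 + n2); apply: mwalk_cat w1 w2. Qed.

Lemma lo2_up u v w s t : lo2 u v s -> up2 v w t -> t <= s -> lo2 u w (s - t).
Proof.
case=> n1 [x [r [w1 e]]] [n2 w2] ts; exists (n1 + n2), (x + 0), (r + t).
by split; [apply: mwalk_cat w1 w2 | move: e ts; clear; lia].
Qed.

Lemma lo2_le_up u v s t : lo2 u v s -> up2 u v t -> s <= t.
Proof.
case=> n1 [x [r [w1 e]]] [n2 /(mwalk_rev lC) w2].
have [H _] := closed (mwalk_cat w1 w2).
by move: (H erefl) e; clear; lia.
Qed.

Lemma lo2_delta u v t : lo2 u v t -> t <= delta.
Proof.
by case=> n [x [r [w e]]]; move: (mwalk_le l_le w) e; clear; lia.
Qed.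

Lemma up2_gt0 u v t : u != v -> up2 u v t -> 0 < t.
Proof.
move=> uv [n w]; move: (mwalk_gt0 uv w) (mwalk_size l_le w); clear; lia.
Qed.

Lemma up2_nonedge u v t : u != v -> l u v = 0 -> up2 u v t -> 1 < t.
Proof.
move=> uv luv [n w].
by move: (mwalk_gt1 uv luv w) (mwalk_size l_le w); clear; lia.
Qed.

Lemma lo2_nonedge u v t : u != v -> l u v = 0 -> lo2 u v t -> t < delta.
Proof.
move=> uv luv [n [x [r [w e]]]].
move: (mwalk_gt1 uv luv w) (mwalk_size l_le w) (mwalk_le l_le w) e.
by clear; lia.
Qed.

Lemma centreP u v : K.-1 <= centre u v <= K.
Proof. by rewrite /centre; case: ifP => _; clear; lia. Qed.

Variable d : V -> V -> nat.
Hypothesis dC : forall u v, u != v ->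
  clamped (up2 u v) (lo2 u v) (centre u v) (d u v).

Definition far u v : Prop :=
  forall n k x r, mwalk l u v n k x r -> K + x < r + 2 * K * k.

(** Every distance is witnessed by a walk of the same parity and no larger [mu]-length, unless all
    walks are long, in which case the distance is [K]. *)
Lemma d2_walk u v : u != v -> (far u v /\ d u v = K) \/
  exists n k x r, [/\ mwalk l u v n k x r, odd (x + r) = odd (d u v)
                    & r + 2 * K * k <= mu (d u v) + x].
Proof.
have [d1 d2 oK] := dP; move=> uv; have [_ _ U L] := dC uv.
have cP := centreP u v; case: (ltngtP (d u v) (centre u v)) => [lt|gt|eq].
- have [n w] := U lt; right; exists n, 0, 0, (d u v); split=> //.
  by rewrite /mu; move: lt cP; clear; lia.
- have [n [x [r [w e]]]] := L gt; right; exists n, 1, x, r; split=> //.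
    by rewrite -e; clear; lia.
  by rewrite /mu; move: gt cP e; clear; lia.
move: eq; rewrite /centre; case: asboolP => [[n [k [x [r [w e1 e2]]]]]|nf] ->.
  right; exists n, k, x, r; split=> //; first by rewrite e1; move: oK; clear; lia.
  (* The [mu]-length bound of the walk is even and at most the odd [K], hence at most [K - 1]. *)
  by rewrite /mu; move: oK e1 e2 d1 d2; clear; lia.
have [[n [k [x [r [w e1 e2]]]]]|nt] := EM (short u v true).
  right; exists n, k, x, r; rewrite oK; split=> //.
  by move: e2; rewrite /mu; clear; lia.
left; split=> // n k x r w; rewrite ltnNge; apply/negP=> le.
by case ox: (odd (x + r)); [apply: nt | apply: nf]; exists n, k, x, r.
Qed.

Lemma d2_le u v : u != v -> d u v <= delta.
Proof.
have [d1 d2 oK] := dP; move=> uv; have [_ _ _ L] := dC uv.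
have [le|/L/lo2_delta //] := leqP (d u v) (centre u v).
by move: le (centreP u v) d2; clear; lia.
Qed.

Lemma d2_gt0 u v : u != v -> 0 < d u v.
Proof.
have [d1 d2 oK] := dP; move=> uv; have [_ _ U _] := dC uv.
have [le|/U/(up2_gt0 uv) //] := leqP (centre u v) (d u v).
by move: le (centreP u v) d1 d2; clear; lia.
Qed.

Lemma d2_triangle x y z : x != y -> y != z -> x != z ->
  d x z <= d x y + d y z.
Proof.
move=> xy yz xz; have [d1 d2 _] := dP.
have [U1 L1 u1 l1] := dC xy; have [U2 L2 u2 l2] := dC yz.
have [U3 L3 u3 l3] := dC xz; have c_le := d2_le xz.
have := centreP x y; have := centreP y z; have := centreP x z => mc mb ma.
have [aM|aM] := ltnP (d x y) (centre x y);
  have [bM|bM] := ltnP (d y z) (centre y z).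
- by apply: U3; apply: up2_up (u1 aM) (u2 bM).
- rewrite leqNgt; apply/negP=> lt; have a0 := d2_gt0 xy.
  have /l3 L : centre x z < d x z by move: bM lt a0 mc mb; clear; lia.
  have /L2 : lo2 y z (d x z - d x y).
    apply: lo2_sym; apply: lo2_up (lo2_sym L) (u1 aM) _.
    by move: lt; clear; lia.
  by move: lt; clear; lia.
- rewrite leqNgt; apply/negP=> lt; have b0 := d2_gt0 yz.
  have /l3 L : centre x z < d x z by move: aM lt b0 mc ma; clear; lia.
  have /L1 : lo2 x y (d x z - d y z).
    by apply: lo2_up L (up2_sym (u2 bM)) _; move: lt; clear; lia.
  by move: lt; clear; lia.
(* Both sides are at least [K - 1], and [2 * (K - 1) >= delta] holds because [delta] is at least
   8. *)
by move: aM bM c_le d1 d2 ma mb; clear; lia.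
Qed.

Lemma d2_sym u v : u != v -> d u v = d v u.
Proof.
move=> uv; have vu : v != u by rewrite eq_sym.
apply: clamped_unique (dC uv) _.
have -> : centre u v = centre v u.
  rewrite /centre (_ : `[< short u v false >] = `[< short v u false >]) //.
  by apply: asbool_equiv_eq; split; apply: short_sym.
by apply: clamped_eq (dC vu) => s; split; by [exact: up2_sym | exact: lo2_sym].
Qed.

Lemma mu_d2_gt0 u v : u != v -> 0 < mu (d u v).
Proof.
move=> uv; have : 0 < d u v <= delta by rewrite d2_gt0 ?d2_le.
by case/mu_gt0/andP.
Qed.

(** If another side has [mu]-value [K], two such sides and a positive third suffice. Otherwise the
    walks of the other two sides compose to a walk from [x] to [z], which is long. *)
Lemma d2_far x y z : x != y -> y != z -> x != z -> far x z -> d x z = K ->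
  2 * K < mu (d x y) + mu (d y z) + mu (d x z).
Proof.
move=> xy yz xz fxz dxz; have muK : mu K = K by rewrite /mu; clear; lia.
rewrite dxz muK.
case: (d2_walk xy) => [[_ ->]|[n1 [k1 [x1 [r1 [w1 _ c1]]]]]].
  by rewrite muK; move: (mu_d2_gt0 yz); clear; lia.
case: (d2_walk yz) => [[_ ->]|[n2 [k2 [x2 [r2 [w2 _ c2]]]]]].
  by rewrite muK; move: (mu_d2_gt0 xy); clear; lia.
move: (fxz _ _ _ _ (mwalk_cat w1 w2)) c1 c2; rewrite mulnDr; clear; lia.
Qed.

Lemma d2_odd x y z : x != y -> y != z -> x != z ->
  odd (d x y + d y z + d x z) ->
  2 * K < mu (d x y) + mu (d y z) + mu (d x z).
Proof.
move=> xy yz xz op; have [yx zy zx] : [/\ y != x, z != y & z != x].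
  by split; rewrite eq_sym.
case: (d2_walk xz) => [[fxz dxz]|[n3 [k3 [x3 [r3 [w3 o3 c3]]]]]].
  exact: d2_far.
case: (d2_walk xy) => [[fxy dxy]|[n1 [k1 [x1 [r1 [w1 o1 c1]]]]]].
  by have := d2_far xz zy xy fxy dxy; rewrite (d2_sym zy); clear; lia.
case: (d2_walk yz) => [[fyz dyz]|[n2 [k2 [x2 [r2 [w2 o2 c2]]]]]].
  by have := d2_far yx xz yz fyz dyz; rewrite (d2_sym yx); clear; lia.
have [_ H] := closed (mwalk_cat (mwalk_cat w1 w2) (mwalk_rev lC w3)).
have /H : odd (x1 + x2 + x3 + (r1 + r2 + r3)).
  by move: op o1 o2 o3; clear; lia.
by rewrite !mulnDr; move: c1 c2 c3; clear; lia.
Qed.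

Lemma d2_allowed x y z : x != y -> y != z -> x != z ->
  triangle_allowed K K (3 * delta + 2) (4 * K + 1) (d x y) (d y z) (d x z).
Proof.
move=> xy yz xz; have := d2_odd xy yz xz.
have := d2_le xy; have := d2_le yz; have := d2_le xz; have [d1 d2 _] := dP.
rewrite /triangle_allowed /mu => cP bP aP o; split=> op; last first.
  by move: aP bP cP; clear; lia.
by move: (o op) aP bP cP d1 d2; clear; split; lia.
Qed.

End Completion2.

Lemma completable2 (V : finType) (l : V -> V -> nat) :
  (forall u v, l u v = l v u) -> (forall u, l u u = 0) ->
  (forall u v, l u v <= delta) ->
  (forall t, cycle (adj l) t -> 0 < size t -> good2 (cyc_labels l t)) ->
  completable delta K K (3 * delta + 2) (4 * K + 1) l.
Proof.
move=> lC l0 l_le gl; have [d1 d2 oK] := dP.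
have cl : forall u n k x r, mwalk l u u n k x r -> mark_ok2 k x r.
  by apply: (mwalk_closed l_le gl) => [w k x r|]; [apply: good2_mark | split].
have /choice[d0 d0P] : forall p : V * V, exists t, if p.1 == p.2 then t = 0
    else clamped (up2 l p.1 p.2) (lo2 l p.1 p.2) (centre l p.1 p.2) t.
  case=> u v /=; case: eqP => _; first by exists 0.
  apply: (@clamped_exists _ _ _ delta) => [s t|s]; first exact: lo2_le_up.
  exact: lo2_delta.
pose d u v := d0 (u, v).
have dr u : d u u = 0 by have := d0P (u, u); rewrite /= eqxx.
have dC u v : u != v -> clamped (up2 l u v) (lo2 l u v) (centre l u v) (d u v).
  by move=> uv; have := d0P (u, v); rewrite /= (negPf uv).
exists d; split.
- split=> // u v; have [->|uv] := eqVneq u v; first by [].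
  exact: (d2_sym lC dC).
- split=> u v uv; first by rewrite (d2_gt0 l_le dC) ?(d2_le l_le dC).
  have nuv : u != v by apply: contraL uv => /eqP->; rewrite l0.
  have [U L _ _] := dC _ _ nuv; apply/eqP; rewrite eqn_leq U ?L //.
    exists 1, (l u v), 0; split; last exact: addn0.
    exact: mwalk_on.
  by exists 1; apply: mwalk_off.
- move=> u v uv luv; have [_ _ U L] := dC _ _ uv; have mc := centreP l u v.
  case: (ltngtP (d u v) (centre l u v)) => [dM|dM|->].
  + have := up2_nonedge l_le uv luv (U dM).
    by move: dM mc d1 d2; clear; lia.
  + have := lo2_nonedge l_le uv luv (L dM).
    by move: dM mc d1 d2; clear; lia.
  by move: mc d1 d2; clear; lia.
- move=> F FI lF u v; have [->|uv] := eqVneq u v; first by rewrite !dr.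
  have Fuv : F u != F v by rewrite (inj_eq FI).
  apply: clamped_unique (dC _ _ Fuv) _.
  have mF := mwalk_aut FI lF.
  have -> : centre l (F u) (F v) = centre l u v.
    rewrite /centre (_ : `[< _ >] = `[< short l u v false >]) //.
    apply: asbool_equiv_eq; split=> -[n [k [x [r [/mF w e1 e2]]]]];
      by exists n, k, x, r.
  apply: clamped_eq (dC _ _ uv) => s; split.
  + by case=> n w; exists n; apply/mF.
  + by case=> n /mF w; exists n.
  + by case=> n [x [r [w e]]]; exists n, x, r; split=> //; apply/mF.
  by case=> n [x [r [/mF w e]]]; exists n, x, r.
move=> x y z xy yz xz; split; first exact: (d2_triangle lC l_le dC).
exact: (d2_allowed lC l_le cl dC).
Qed.

End CaseTwo.

(** * Parameters that admit a Henson constraint *)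

Lemma case_II_henson delta K1 K2 C0 C1 (X : metricSpace) :
  primitive_admissible_num delta K1 K2 C0 C1 -> case_II delta K1 K2 C0 C1 ->
  henson_constraint delta X -> (exists i : 'I_4 -> X, injective i) ->
  no_forbidden_triangle K1 K2 C0 C1 X ->
  [/\ K2 = K1, C0 = 3 * delta + 2, C1 = 4 * K1 + 1
    & [/\ 7 < delta, 3 * K1 + 1 = 2 * delta & odd K1]].
Proof.
case=> d3 [[k1 k2 k3] [[c0 c1 o0 o1] [[e0 e1] _]]] [h1 h2 h3 h4 h5] hX [i iI] tX.
have ne (a b : 'I_4) : a != b -> i a <> i b by move=> ab /iI/eqP; apply/negP.
have [xM xC xT] := dist_metric X.
have [n01 n12 n02] : [/\ i 0%R <> i 1%R, i 1%R <> i (inord 2)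
    & i 0%R <> i (inord 2)].
  by split; apply: ne; rewrite -val_eqE /= ?inordK.
move: (tX _ _ _ n01 n12 n02) (hX _ _ n01) (hX _ _ n12) (hX _ _ n02).
move: (xT (i 0%R) (i 1%R) (i (inord 2))) (xT (i 1%R) (i 0%R) (i (inord 2))).
move: (xT (i 0%R) (i (inord 2)) (i 1%R)); rewrite (xC (i 1%R) (i 0%R)).
rewrite (xC (i (inord 2)) (i 1%R)).
move: (dist _ _) (dist _ _) (dist _ _) => b c a t1 t2 t3.
rewrite /triangle_allowed => -[todd teven] aE bE cE.
have K2d : K2 < delta by move: h4 k1; clear; lia.
have K1gt : 1 < K1.
  by move: h2 h4 e0 e1; clear; lia.
have [Ea Eb Ec] : [/\ a = delta, b = delta & c = delta].
  (* A metric triangle with sides 1 and [delta] only, and some side 1, has sides 1, 1, 1 or 1,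
     [delta], [delta]. Its perimeter is odd and violates the [K1] bound or the [K2] bound
     respectively. *)
  have o : (a = 1 \/ b = 1 \/ c = 1) -> False.
    move=> one; have op : odd (a + b + c).
      by move: one t1 t2 t3 aE bE cE d3; clear; lia.
    have [p1 p2 _] := todd op.
    by move: one t1 t2 t3 aE bE cE d3 p1 p2 K2d K1gt; clear; lia.
  by move: o aE bE cE; clear; intuition.
rewrite Ea Eb Ec in todd teven.
have K1d : 3 * K1 + 1 <= 2 * delta by move: h4 k2 k1; clear; lia.
case: h5 => [h5|[h5 h6 h7]].
  have : 3 * delta < maxn C0 C1.
    case: (boolP (odd (delta + delta + delta))) => [/todd[_ _]|/teven].
      by clear; lia.
    by clear; lia.
  by move: h1 h5 K1d d3; clear; lia.
have CC : minn C0 C1 = C1.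
  by move: h2 o0 o1; clear; lia.
rewrite CC in h1 h2 h5.
have ed : ~~ odd (delta + delta + delta).
  by apply/negP=> /todd[_ _]; move: h1 K1d d3; clear; lia.
have C0E : C0 = 3 * delta + 2.
  by move: ed c0 o0 (teven ed); clear; lia.
split=> //; first by move: h2 h6; clear; lia.
(* As [delta] is even, 4 divides [3 * K1 + 1]. The solution [K1 = 1] gives [delta = 2], and the next
   one is [K1 = 5], [delta = 8]. *)
by move: h6 h7 d3 ed; clear; split; lia.
Qed.

Lemma magic_parameter delta K1 K2 C0 C1 :
  primitive_admissible_num delta K1 K2 C0 C1 -> case_III delta K1 K2 C0 C1 ->
  K1 <> delta -> minn C0 C1 <> 2 * delta + 2 ->
  let C := minn C0 C1 in let C' := maxn C0 C1 in exists E M,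
  [/\ [/\ 2 < delta, 0 < K1, K1 <= M, 1 < M & M < delta],
      [/\ delta <= 2 * M, 2 * delta <= M + 2 * K2,
          2 * delta <= K1 + 2 * K2 + 1, 2 * M + delta <= E & M <= K2],
      [/\ 2 * delta + 2 <= E, 2 * delta + K1 <= E
        & 2 * delta = K1 + 2 * K2 + 1 -> 2 * delta + K1 + 1 <= E]
    & [/\ C' = E + 2, ~~ odd C0, odd C1
        & C.+1 < C' -> 2 * delta + K2 <= C /\ 2 * delta + M + 1 <= C]].
Proof.
case=> d3 [[k1 k2 k3] [[c0 c1 o0 o1] [[e0 e1] _]]] [h1 h2 h3 h4 h5] nK nC C C'.
(* The default distance is the least one satisfying [K1 <= M], [delta <= 2 * M] and
   [2 * delta <= M + 2 * K2]. *)
exists (C' - 2), (maxn K1 (maxn (uphalf delta) (2 * delta - 2 * K2))).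
have CC : C < C' by rewrite /C /C'; move: o0 o1; clear; lia.
move: h1 h2 h3 h4 h5 nC; rewrite -/C -/C' => h1 h2 h3 h4 h5 nC.
have Cle : C' <= 3 * delta + 2 by rewrite /C'; move: c0 c1; clear; lia.
have Cge : 2 * delta + 3 <= C by rewrite /C in nC *; move: nC e0 e1; clear; lia.
have K1d : K1 < delta by move: h1 CC Cle nK; clear; lia.
move: (C) (C') {nC} CC h1 h4 h5 Cle Cge => {}C {}C' CC h1 h4 h5 Cle Cge.
split.
- by move: d3 k1 K1d h3; clear; split; lia.
- by move: d3 k1 k2 K1d h1 h2 h3 h4 CC Cge; clear; split; lia.
- by move: CC h1 h4 Cge k1; clear; split; lia.
split=> //; first by move: CC Cge; clear; lia.
move=> big; have /h5 h5' : C' > C + 1 by move: big; clear; lia.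
split=> //; move: d3 k1 k2 K1d h1 h2 h3 h4 h5' Cge; clear; lia.
Qed.

Theorem theorem5p5 (delta K1 K2 C0 C1 : nat) (S : metricSpace -> Prop)
    (Hadm : primitive_admissible delta K1 K2 C0 C1 S)
    (Hnonempty : exists X : metricSpace, S X)
    (Hhenson : forall X : metricSpace, S X -> henson_constraint delta X) :
  coherent_EPPA
    (fun A => class_A delta K1 K2 C0 C1 A /\ class_AS S A).
Proof.
have [num SP S3] := Hadm; have [X SX] := Hnonempty; have [hX iX tX] := SP X SX.
have [_ [_ [_ [_ [cII|cIII]]]]] := num.
  have [-> -> -> dP] := case_II_henson num cII hX iX tX.
  apply: EPPA_of_completion (word_class2 dP) _ _ Hhenson.
    exact: (good2_triangle dP).
  exact: (completable2 dP).
have [] := @magic_parameter delta K1 K2 C0 C1 num cIII.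
- by move=> E; apply: S3 cIII (or_introl E) X SX.
- by move=> E; apply: S3 cIII (or_intror E) X SX.
move=> E [M [dK dM dE dC]].
apply: EPPA_of_completion (word_class3 dK dM dE dC) _ _ Hhenson.
  by move=> a b c _ _ _; apply: (good3_triangle dC).
exact: (completable3 dK dM dE dC).
Qed.
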